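(* Let $\alpha \ge 0$. Let $T_\infty$ be a $\mathrm{BGW}(2,1/2)$ tree conditioned on non-extinction (Kesten's tree). Assume that an independent $\mathrm{Po}(\alpha)$ number of cars arrives at each of the vertices of $T_\infty$, and let $A_\alpha$ be the event that all of the arriving cars can park on $T_\infty$. Then $$\mathbb{P}(A_\alpha) = \begin{cases} e^{\alpha/2} \sqrt{\dfrac{\alpha^2 - 4\alpha + 2}{2(1-\alpha)}} & \text{if } 0 \leq \alpha \leq 2-\sqrt{2}, \\[2mm] 0 & \text{if } \alpha > 2-\sqrt{2}. \end{cases}$$
   Context: $\mathrm{BGW}(2,1/2)$ denotes the law of the family tree of a Galton–Watson branching process (started from a single root individual) with $\mathrm{Bin}(2,1/2)$ offspring distribution $\nu$, i.e. each individual independently has $0,1,2$ children with probabilities $1/4,1/2,1/4$. $\mathrm{Po}(\alpha)$ is the Poisson distribution with mean $\alpha$ (a point mass at $0$ if $\alpha=0$). Construction of $T_\infty$: take an infinite path (the spine) $S_0,S_1,S_2,\dots$ rooted at $S_0$, where $S_{h}$ is the parent of $S_{h+1}$. Independently for each $h\ge 0$, attach to $S_h$ a random number $\tilde N_h$ of additional children, where $\tilde N_h$ has law $\tilde\nu(i) = (i+1)\nu(i+1)$, i.e. $\mathbb{P}(\tilde N_h=0)=\mathbb{P}(\tilde N_h=1)=\tfrac12$. Each such additional child is the root of an independent $\mathrm{BGW}(2,1/2)$ tree. All edges are directed towards the root $S_0$. The numbers of cars arriving at the vertices are independent $\mathrm{Po}(\alpha)$ given the tree. Parking process: each vertex is a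 parking space holding at most one car. A car arriving at an unoccupied vertex parks there; otherwise it follows the unique directed path towards the root and parks at the first unoccupied vertex it encounters; if it finds none, it leaves the tree through the root. The set of vertices finally occupied and the number of cars leaving do not depend on the order in which finitely many cars are processed. ''All of the arriving cars can park on $T_\infty$'' means that no car leaves through the root, i.e. for every $h\ge 0$, when only the (almost surely finitely many) cars arriving at $S_0,\dots,S_h$ and at the vertices of the finite trees attached to $S_0,\dots,S_h$ are parked, no car leaves through $S_0$. *)

(* Defs.v *)
From HB Require Import structures.
From mathcomp Require Import all_boot all_order all_algebra.
From mathcomp Require Import all_classical all_reals all_analysis.

Set Implicit Arguments.
Unset Strict Implicit.
Unset Printing Implicit Defensive.

Import Order.TTheory GRing.Theory Num.Theory.

Local Open Scope classical_set_scope.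
Local Open Scope ring_scope.

Definition mutually_independent (d : measure_display) (Omega : measurableType d)
    (R : realType) (P : probability Omega R) (d' : measure_display)
    (T : measurableType d') (I : eqType) (Y : I -> {RV P >-> T}) : Prop :=
  forall (J : seq I) (B : I -> set T), uniq J ->
    (forall i, measurable (B i)) ->
    P (\bigcap_(i in [set` J]) (Y i @^-1` B i)) =
      (\prod_(i <- J) P (Y i @^-1` B i))%E.

(* The law Bin(2, 1/2). *)
Definition nu (R : realType) : set nat -> \bar R := binomial_prob 2 (2^-1 : R).

(* The law Po(alpha). The second argument of [poisson_prob] is unused; for    *)
(* alpha = 0 this is the Dirac mass at 0.                                     *)
Definition Po (R : realType) (alpha : R) : set nat -> \bar R :=
  poisson_prob alpha 0.

(* Ulam-Harris labels relative to the spine: (h, [::]) is the spine vertex    *)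
(* S_h, and (h, [:: i; j; ...]) is the descendant of S_h reached by going to  *)
(* its i-th additional child, then to the j-th child of that vertex, etc.     *)
(* (counting from 0). The spine child S_(h+1) of S_h is not counted among the *)
(* additional children of S_h.                                                *)
Definition vertex := (nat * seq nat)%type.

Section Parking.
Local Open Scope nat_scope.

(* k (h, [::]) is the number of additional children of S_h, and k v is the    *)
(* number of children of v for an off-spine vertex v. A label belongs to the  *)
(* tree when each step from the spine goes to an existing child.              *)
Definition in_tree (k : vertex -> nat) (v : vertex) : bool :=
  all (fun j => nth 0 v.2 j < k (v.1, take j v.2)) (iota 0 (size v.2)).

(* The directed path from v (included) to the root S_0 (included): first from *)
(* v to the spine, then down the spine.                                       *)
Definition route (v : vertex) : seq vertex :=
  [seq (v.1, take j v.2) | j <- rev (iota 0 (size v.2).+1)] ++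
  [seq (j, [::]) | j <- rev (iota 0 v.1)].

(* State: the occupied vertices and the number of cars that left the tree. *)
Definition park_car (st : seq vertex * nat) (v : vertex) : seq vertex * nat :=
  if [seq u <- route v | u \notin st.1] is u :: _ then (u :: st.1, st.2)
  else (st.1, st.2.+1).

(* A sequence of cars is given by the sequence of their arrival vertices. *)
Definition cars_leaving (s : seq vertex) : nat :=
  (foldl park_car ([::], 0) s).2.

(* s lists the cars arriving at S_0, ..., S_h and at the vertices of the      *)
(* trees attached to S_0, ..., S_h, when x v cars arrive at v.                *)
Definition lists_arrivals (k x : vertex -> nat) (h : nat) (s : seq vertex)
    : Prop :=
  forall v, count_mem v s = if (v.1 <= h) && in_tree k v then x v else 0.

(* The order of s does not influence [cars_leaving s]. A list s exists as     *)
(* soon as finitely many cars are concerned, hence almost surely in the       *)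
(* random setting.                                                            *)
Definition all_cars_park (k x : vertex -> nat) : Prop :=
  forall h, exists2 s, lists_arrivals k x h s & cars_leaving s = 0.

End Parking.

(* Main.v *)
(* Discarding the vertices at distance more than n from the spine, let F_n
   and H_n be the probability generating functions of the number of cars
   visiting the root of an off-spine subtree, respectively a spine vertex when
   the cars coming from further up the spine are ignored.  Both satisfy
   recursions whose limits F, H give, with q = F(0),
     (H(s) - s)^2 = s^2 - exp(-alpha (1 - s)) (s - (1 - s) q).
   The cars passing through S_0 form a Lindley queue with increments of
   generating function H, and the recursion of the queue gives
     P(A) H(0) (1 - s) = G(s) (H(s) - s)
   for a generating function G, so that P(A) H(0) is the limit of
   (H(s) - s) / (1 - s) at 1 if H lies above the diagonal near 1, and
   P(A) = 0 if H lies below it.  Positivity of the square forces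
   q >= 1 - alpha.  If q > 1 - alpha the square is of order 1 - s, and H must
   lie below the diagonal since H <= 1.  If q = 1 - alpha the square is
   equivalent to (alpha^2 - 4 alpha + 2) (1 - s)^2 / 2, which excludes
   alpha > 2 - sqrt 2.  Conversely, if alpha <= 2 - sqrt 2 the right-hand side
   is positive on [0, 1), so that H, which is nondecreasing and positive at 0,
   stays above the diagonal, hence q = 1 - alpha. *)

Require Import Defs.
From HB Require Import structures.
From mathcomp Require Import all_boot all_order all_algebra.
From mathcomp Require Import all_classical all_reals all_analysis.
From mathcomp Require Import measurable_realfun.
From mathcomp Require Import zify ring lra.

Import Order.TTheory GRing.Theory Num.Theory.

Local Open Scope classical_set_scope.
Local Open Scope ring_scope.

Set Implicit Arguments.
Unset Strict Implicit.
Unset Printing Implicit Defensive.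

(** * Parking on a binary tree *)

Section Combinatorics.
Local Open Scope nat_scope.

Implicit Types (k x a N : vertex -> nat) (u v : vertex).

(* The number of cars visiting (h, w) when the cars arriving at least n
   generations away from it or on the spine beyond S_h are ignored; offspring
   numbers above 2 have probability 0. *)
Fixpoint visits k x n h w : nat :=
  if n is m.+1 then
    x (h, w) + ((0 < k (h, w)) * (visits k x m h (rcons w 0)).-1 +
                (1 < k (h, w)) * (visits k x m h (rcons w 1)).-1)
  else 0.

(* The number of cars leaving through S_h among those arriving at S_h, ...,
   S_(h+m-1) and in their bushes. *)
Fixpoint overflow k x n m h : nat :=
  if m is m'.+1 then (visits k x n h [::] + overflow k x n m' h.+1).-1 else 0.

(** When [N] counts the cars visiting each vertex, a visited vertex keeps one car and sends the
    others on, hence the truncated predecessors. A spine vertex also receives cars from the next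
    spine vertex. *)
Definition inflow N u : nat :=
  (N (u.1, rcons u.2 0)).-1 + (N (u.1, rcons u.2 1)).-1 +
  (u.2 == [::]) * (N (u.1.+1, [::])).-1.

(** This is [park_car] with an arbitrary path as route, so that inductions can follow the route
    vertex by vertex. *)
Definition park_along (r : seq vertex) (st : seq vertex * nat) :=
  if [seq u <- r | u \notin st.1] is u :: _ then (u :: st.1, st.2)
  else (st.1, st.2.+1).

Lemma park_along_cons u r st : park_along (u :: r) st =
  if u \in st.1 then park_along r st else (u :: st.1, st.2).
Proof. by rewrite /park_along /=; case: (u \in st.1). Qed.

Lemma route_rcons h w j :
  route (h, rcons w j) = (h, rcons w j) :: route (h, w).
Proof.
rewrite /route size_rcons -[(size w).+2]addn1 iotaD rev_cat map_cat /=.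
rewrite -{1}(size_rcons w j) take_size; congr (_ :: _ ++ _).
apply/eq_in_map => i; rewrite mem_rev -/(iota 0 (size w).+1) mem_iota => /andP[_ ile].
congr pair; rewrite -cats1 take_cat; case: ltnP => // wi.
by rewrite (_ : i - size w = 0) ?take0 ?cats0 ?take_oversize//; lia.
Qed.

Lemma route_spine h : route (h.+1, [::]) = (h.+1, [::]) :: route (h, [::]).
Proof. by rewrite /route [_.1 in RHS]/= -[h.+1]addn1 iotaD rev_cat /= add0n addn1. Qed.

(** Conservation of cars: [N] counts visits, [a] counts arrivals, and the occupied vertices are the
    visited ones. *)
Definition settled N a (st : seq vertex * nat) :=
  [/\ forall u, N u = a u + inflow N u,
      forall u, (u \in st.1) = (0 < N u) & st.2 = (N (0, [::])).-1].

(* A car driving through [v] that [N] does not count yet. *)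
Definition pending v N a (st : seq vertex * nat) :=
  [/\ forall u, N u + (u == v) = a u + inflow N u,
      forall u, (u \in st.1) = (0 < N u) & st.2 = (N (0, [::])).-1].

(** The count at [v] rises from 0 to 1, which changes no truncated predecessor and hence no
    inflow. *)
Lemma pending_free v N a st : pending v N a st -> v \notin st.1 ->
  settled (fun u => N u + (u == v)) a (v :: st.1, st.2).
Proof.
move=> [flowN occN outN]; rewrite occN lt0n negbK => /eqP Nv.
have pE u : (N u + (u == v)).-1 = (N u).-1.
  by case: eqP => [->|]; rewrite ?Nv ?addn0.
split=> [u|u|] /=; last by rewrite pE.
  by rewrite flowN /inflow !pE.
by rewrite inE occN; case: eqP => /=; lia.
Qed.

Lemma pred_addb m (b : bool) : (b -> 0 < m) -> (m + b).-1 = m.-1 + b.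
Proof. by case: b => [/(_ isT)|]; lia. Qed.

(** An occupied [v] sends the additional car on; the first hypothesis says that it reaches [v']
    next. *)
Lemma pending_taken v v' N a st :
  (forall u, inflow (fun u => N u + (u == v)) u = inflow N u + (u == v')) ->
  (0, [::]) != v -> v \in st.1 -> pending v N a st ->
  pending v' (fun u => N u + (u == v)) a st.
Proof.
move=> vv' v0 vst [flowN occN outN]; split=> [u|u|].
- by rewrite vv' addnA -flowN.
- by rewrite occN; case: eqP => [->|]; rewrite ?addn0 // addn1 -occN vst.
- by rewrite (negbTE v0) addn0.
Qed.

(** Induction along the route: down the bush to the spine, then down the spine to the root. *)
Lemma pending_park v N a st : all (fun j => j < 2) v.2 -> pending v N a st ->
  exists N', settled N' a (park_along (route v) st).
Proof.
case: v => h w /=; elim/last_ind: w N => [|w j IHw] N.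
  move=> _; elim: h N => [|h IHh] N pN.
    rewrite (_ : route _ = [:: (0, [::])]) // park_along_cons.
    case: ifPn => [vst|vst]; last by eexists; exact: pending_free pN vst.
    case: pN => [flowN occN outN].
    (* The root is no vertex's child, so the additional visit changes no inflow and only raises the
       number of cars leaving. *)
    exists (fun u => N u + (u == (0, [::]))); split=> [u|u|].
    - rewrite flowN /inflow; congr (_ + (_ + _ + _ * _));
        rewrite [_ == _](_ : _ = false) ?addn0 //.
      + by apply/eqP => -[_]; case: (u.2).
      + by apply/eqP => -[_]; case: (u.2).
    - by rewrite occN; case: eqP => [->|]; rewrite ?addn0 // addn1 -occN vst.
    - by move: vst; rewrite occN /= outN; lia.
  rewrite route_spine park_along_cons.
  case: ifPn => [vst|vst]; last by eexists; exact: pending_free pN vst.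
  have Nv : 0 < N (h.+1, [::]) by case: pN => _ <-.
  apply: IHh; apply: pending_taken vst pN => // -[h' w'].
  rewrite /inflow /= !xpair_eqE.
  have rcF i : (rcons w' i == [::]) = false by case: w'.
  rewrite !rcF !andbF !addn0 andbT pred_addb; last by move/eqP => ->.
  by rewrite eqSS mulnDr mulnb andbC addnA.
rewrite all_rcons => /andP[j2 w2] pN; rewrite route_rcons park_along_cons.
case: ifPn => [vst|vst]; last by eexists; exact: pending_free pN vst.
have Nv : 0 < N (h, rcons w j) by case: pN => _ <-.
apply: (IHw _ w2); apply: pending_taken vst pN => [[h' w']|]; last first.
  by apply/eqP => -[_]; case: (w).
rewrite /inflow /= !xpair_eqE.
have -> : ([::] == rcons w j) = false by case: (w).
rewrite andbF addn0 !eqseq_rcons !pred_addb;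
  try by case/and3P => /eqP -> /eqP -> /eqP jE; rewrite [X in rcons _ X]jE.
clear -j2; case: j j2 => [|[|//]] _ /=; rewrite ?andbF ?andbT ?addn0 ; lia.
Qed.

Lemma settled_cars (s : seq vertex) : all (fun v : vertex => all (fun j => j < 2) v.2) s ->
  exists N, settled N (fun v => count_mem v s) (foldl park_car ([::], 0) s).
Proof.
elim/last_ind: s => [_|s v IHs]; first by exists (fun=> 0); split => //= u; rewrite /inflow muln0.
rewrite all_rcons => /andP[v2 /IHs[N [flowN occN outN]]].
rewrite foldl_rcons; apply: (@pending_park v N _ _ v2); split => // u.
by rewrite flowN -cats1 count_cat /= addn0 eq_sym addnAC.
Qed.

Lemma in_tree_rcons k h w j :
  in_tree k (h, rcons w j) = in_tree k (h, w) && (j < k (h, w)).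
Proof.
rewrite /in_tree /= size_rcons -[(size w).+1]addn1 iotaD all_cat /= add0n andbT.
rewrite nth_rcons ltnn eqxx -cats1 take_size_cat //; congr (_ && _).
apply: eq_in_all => i; rewrite mem_iota => /andP[_ iw].
by rewrite nth_cat iw takel_cat // ltnW.
Qed.

Lemma in_tree_binary k v : (forall u, k u <= 2) -> in_tree k v ->
  all (fun j => j < 2) v.2.
Proof.
case: v => h w k2; elim/last_ind: w => // w j IHw.
rewrite in_tree_rcons all_rcons => /andP[/IHw -> jk].
by rewrite andbT (leq_trans jk).
Qed.

(** * Balanced flows of finite support *)

Section OverflowOfSettled.
Variables (k x N : vertex -> nat) (h D : nat).
Let alive v := (v.1 <= h) && in_tree k v.
Hypothesis flowN : forall u, N u = (if alive u then x u else 0) + inflow N u.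
Hypothesis boundN : forall u, 0 < N u -> size u.2 + u.1 < D.

Let N0 u : D <= size u.2 + u.1 -> N u = 0.
Proof.
by move=> Du; apply/eqP; rewrite -leqn0 leqNgt; apply/negP => /boundN; lia.
Qed.

Let not_alive_rcons h' w j : ~~ alive (h', w) -> ~~ alive (h', rcons w j).
Proof. by apply: contra; rewrite /alive in_tree_rcons /= andbA => /andP[]. Qed.

Let rcons_neq0 (w : seq nat) j : rcons w j != [::].
Proof. by case: w. Qed.

(** A vertex that is not alive has no arrivals and no alive child, so a flow through it would have
    to come from infinitely far. The depth bound [D] excludes this, by induction from depth [D]
    downwards. *)
Lemma settled_not_alive u : ~~ alive u -> N u = 0.
Proof.
have bush m h' (w : seq nat) : D <= size w + m -> w != [::] -> ~~ alive (h', w) ->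
    N (h', w) = 0.
  elim: m w => [|m IHm] w Dm w0 dead; first by apply: N0 => /=; lia.
  rewrite flowN (negbTE dead) /inflow /= (negbTE w0) !IHm ?not_alive_rcons //;
  by rewrite size_rcons addSnnS.
case: u => h' w; have [->|w0] := eqVneq w [::]; last first.
  by apply: (bush D) => //; exact: leq_addl.
have [m Dm] : exists m, D <= h' + m by exists D; exact: leq_addl.
elim: m h' Dm => [|m IHm] h' Dm dead; first by apply: N0 => /=; lia.
have child i : N (h', [:: i]) = 0.
  by apply: (bush D) => //; exact: (@not_alive_rcons h' [::]).
rewrite flowN (negbTE dead) /inflow /= !child IHm ?addSnnS //.
by move: dead; rewrite /alive /in_tree /= !andbT; lia.
Qed.

(** Off the spine the balance equation is the recursion of [visits]; truncating it is harmless
    because [N] vanishes from depth [D] on. *)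
Let visits_alive n h' w : alive (h', w) -> w != [::] -> D <= size w + n ->
  visits k x n h' w = N (h', w).
Proof.
elim: n w => [|n IHn] w al w0 Dn; first by rewrite N0 //=; lia.
have step j : (j < k (h', w)) * (visits k x n h' (rcons w j)).-1 =
    (N (h', rcons w j)).-1.
  have [jk|kj] := ltnP; rewrite ?mul1n ?mul0n.
    rewrite IHn // ?size_rcons ?addSnnS //.
    by move: al; rewrite /alive in_tree_rcons jk andbT.
  by rewrite settled_not_alive // /alive in_tree_rcons ltnNge kj !andbF.
by rewrite /= !step [RHS]flowN al /inflow /= (negbTE w0) addn0.
Qed.

(** Backward induction along the spine from S_(h+1), which no car visits. *)
Lemma overflow_settled n : D < n ->
  overflow k x n h.+1 0 = (N (0, [::])).-1.
Proof.
case: n => // n Dn.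
suff ov m j : j + m = h.+1 -> overflow k x n.+1 m j = (N (j, [::])).-1.
  exact: ov.
elim: m j => [|m IHm] j jm.
  by rewrite settled_not_alive // /alive /=; lia.
have al : alive (j, [::]) by rewrite /alive andbT /=; lia.
have step i : (i < k (j, [::])) * (visits k x n j [:: i]).-1 =
    (N (j, [:: i])).-1.
  have tr : in_tree k (j, [:: i]) = (i < k (j, [::])).
    exact: (in_tree_rcons k j [::] i).
  have [ik|ki] := ltnP; rewrite ?mul1n ?mul0n.
    by rewrite visits_alive //=; [move: al; rewrite /alive tr ik|lia].
  by rewrite settled_not_alive // /alive tr ltnNge ki andbF.
rewrite /= IHm ?addSnnS // [N (j, _)]flowN al /inflow /= !step mul1n.
by rewrite !addnA.
Qed.

End OverflowOfSettled.

(** The overflow does not mention [s], so the order of the cars is seen to be immaterial. *)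
Lemma cars_leaving_overflow k x h s : (forall u, k u <= 2) ->
  lists_arrivals k x h s ->
  exists D, forall n, D <= n -> cars_leaving s = overflow k x n h.+1 0.
Proof.
move=> k2 ls.
have s2 : all (fun v : vertex => all (fun j => j < 2) v.2) s.
  apply/allP => v vs; apply: (in_tree_binary k2).
  have : 0 < count_mem v s by rewrite -has_count has_pred1.
  by rewrite ls; case: ifP => [/andP[]|].
have [N [flowN occN outN]] := settled_cars s2.
set occ := (foldl _ _ _).1 in occN.
(* The visited vertices are the finitely many occupied ones, so their depths are bounded. *)
pose D := (\max_(u <- occ) (size u.2 + u.1)).+1.
exists D.+1 => n Dn; rewrite /cars_leaving outN; apply/esym.
apply: (@overflow_settled k x N h D) => // [u|u Nu].
  by rewrite {1}flowN ls.
have uocc : u \in occ by rewrite occN.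
rewrite ltnS; exact: (@leq_bigmax_seq _ _ _ (fun u => size u.2 + u.1) u uocc).
Qed.

Lemma visitsS k x n h w : visits k x n.+1 h w =
  x (h, w) + ((0 < k (h, w)) * (visits k x n h (rcons w 0)).-1 +
              (1 < k (h, w)) * (visits k x n h (rcons w 1)).-1).
Proof. by []. Qed.

Lemma overflowS k x n m h : overflow k x n m.+1 h =
  (visits k x n h [::] + overflow k x n m h.+1).-1.
Proof. by []. Qed.

Lemma visits_leS k x n h w : visits k x n h w <= visits k x n.+1 h w.
Proof.
elim: n w => // n IHn w; rewrite visitsS [leqRHS]visitsS leq_add2l.
by apply: leq_add; rewrite leq_mul2l -!subn1 leq_sub2r ?orbT // IHn.
Qed.

Lemma overflow_leS k x n m h : overflow k x n m h <= overflow k x n.+1 m h.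
Proof.
elim: m h => // m IHm h.
by rewrite !overflowS -!subn1 leq_sub2r // leq_add // visits_leS.
Qed.

Lemma overflow_leqS k x n m h : overflow k x n m h <= overflow k x n m.+1 h.
Proof.
elim: m h => // m IHm h.
by rewrite overflowS [leqRHS]overflowS -!subn1 leq_sub2r // leq_add.
Qed.

Lemma overflow_homo k x n n' m m' h : n <= n' -> m <= m' ->
  overflow k x n m h <= overflow k x n' m' h.
Proof.
move=> nn' mm'; apply: (@leq_trans (overflow k x n' m h)).
  apply: (@homo_leq _ (fun i => overflow k x i m h) leq) => // [? ? ?|i].
    exact: leq_trans.
  exact: overflow_leS.
apply: (@homo_leq _ (fun i => overflow k x n' i h) leq) => // [? ? ?|i].
  exact: leq_trans.
exact: overflow_leqS.
Qed.

(** No descendant lies [n] generations away, which fails for [n = 0] because the vertex itself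
    counts. Below a spine vertex only the additional children are followed. *)
Fixpoint extinct k n h w : bool :=
  if n is m.+1 then
    ((0 < k (h, w)) ==> extinct k m h (rcons w 0)) &&
    ((1 < k (h, w)) ==> extinct k m h (rcons w 1))
  else false.

Lemma in_tree_cat k h w w' : in_tree k (h, w ++ w') -> in_tree k (h, w).
Proof.
elim/last_ind: w' => [|w' j IHw']; first by rewrite cats0.
by rewrite -rcons_cat in_tree_rcons => /andP[/IHw'].
Qed.

Lemma extinct_size k n h w w' : (forall u, k u <= 2) ->
  extinct k n h w -> in_tree k (h, w ++ w') -> size w' < n.
Proof.
move=> k2; elim: n w w' => // n IHn w [|j w'] //= /andP[ext0 ext1] tr.
rewrite ltnS; apply: (IHn (rcons w j)); last by rewrite cat_rcons.
have jk : j < k (h, w).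
  move: tr; rewrite -cat_rcons => /in_tree_cat.
  by rewrite in_tree_rcons => /andP[].
have := leq_trans jk (k2 (h, w)).
case: j jk {tr} => [|[|//]] jk _.
  by move: ext0; rewrite jk.
by move: ext1; rewrite jk.
Qed.

Lemma finite_support_count (T : eqType) (f : T -> nat) (L : seq T) :
  (forall y, 0 < f y -> y \in L) -> exists s, forall y, count_mem y s = f y.
Proof.
move=> fL; exists (flatten [seq nseq (f y) y | y <- undup L]) => y.
have /(_ (undup L) (undup_uniq L)) -> : forall s : seq T, uniq s ->
    count_mem y (flatten [seq nseq (f y) y | y <- s]) = (y \in s) * f y.
  elim=> //= a s IHs /andP[a_s us]; rewrite count_cat IHs // count_nseq inE.
  by rewrite /= eq_sym; have [->|] := eqVneq y a; rewrite ?(negbTE a_s) ?mul0n ?add0n ?addn0.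
rewrite mem_undup; case: (posnP (f y)) => [->|/fL ->]; first by rewrite muln0.
by rewrite mul1n.
Qed.

Lemma short_binary_words D : exists L : seq (seq nat),
  forall w, size w < D -> all (fun j => j < 2) w -> w \in L.
Proof.
elim: D => [|D [L LP]]; first by exists [::].
exists ([::] :: map (cons 0) L ++ map (cons 1) L) => -[|j w] //= sw /andP[j2 w2].
have wL := LP _ sw w2; rewrite inE /= mem_cat; apply/orP.
by case: j j2 => [|[|//]] _; [left|right]; apply: map_f.
Qed.

(** Finite bushes make the arrivals up to S_h a finite list; monotonicity in both indices bounds the
    overflow of this list by a diagonal one. *)
Lemma overflow0_all_cars_park k x : (forall u, k u <= 2) ->
  (forall h, exists n, extinct k n h [::]) ->
  (forall n, overflow k x n n 0 = 0) -> all_cars_park k x.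
Proof.
move=> k2 kfin ov0 h.
(* A common height bound for the bushes of S_0, ..., S_h. *)
have [D DP] : exists D, forall h' w, h' <= h -> in_tree k (h', w) -> size w < D.
  elim: h => [|h [D DP]].
    have [n en] := kfin 0; exists n => h' w; rewrite leqn0 => /eqP ->.
    exact: (@extinct_size k n 0 [::]).
  have [n en] := kfin h.+1; exists (maxn n D) => h' w.
  rewrite leq_max leq_eqVlt => /predU1P[->|/DP h'D /h'D ->]; last by rewrite orbT.
  by move/(@extinct_size k n h.+1 [::]) => -> //.
have [L LP] := short_binary_words D.
have [s sP] : exists s, lists_arrivals k x h s.
  apply: (@finite_support_count _ _ [seq (i, w) | i <- iota 0 h.+1, w <- L]).
  move=> -[i w]; case: ifP => // /andP[ih tr] _.
  apply: allpairs_f; first by rewrite mem_iota.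
  by apply: LP; [exact: DP tr|exact: in_tree_binary tr].
exists s => //; have [D' /(_ _ (leq_maxl D' h.+1)) ->] := cars_leaving_overflow k2 sP.
have := @overflow_homo k x _ _ _ _ 0 (leqnn (maxn D' h.+1)) (leq_maxr D' h.+1).
by rewrite ov0 leqn0 => /eqP.
Qed.

(** The cars up to S_n involve [n.+1] spine vertices, so their overflow dominates the diagonal
    one. *)
Lemma all_cars_park_overflow0 k x : (forall u, k u <= 2) ->
  all_cars_park k x -> forall n, overflow k x n n 0 = 0.
Proof.
move=> k2 park n; have [s sP s0] := park n.
have [D DP] := cars_leaving_overflow k2 sP.
have := @overflow_homo k x n (maxn D n) n n.+1 0 (leq_maxr _ _) (leqnSn _).
by rewrite -(DP _ (leq_maxl D n)) s0 leqn0 => /eqP.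
Qed.
End Combinatorics.

(** * Solving the recursions *)

Section ExponentialBounds.
Import numFieldNormedType.Exports.
Variable R : realType.
Implicit Types x y K b : R.

(** This replaces the limit b -> 0 in inequalities with a linear error term. *)
Lemma le_affine_small x y K b0 : 0 < b0 ->
  (forall b : R, 0 < b -> b <= b0 -> x <= y + K * b) -> x <= y.
Proof.
move=> b00 xy; apply/ler_addgt0Pl => e e0.
pose b := Num.min b0 (e / (`|K| + 1)).
have K1 : 0 < `|K| + 1 by rewrite ltr_pwDr.
have b_gt0 : 0 < b by rewrite lt_min b00 divr_gt0.
apply: (le_trans (xy b b_gt0 _)); first by rewrite ge_min lexx.
rewrite addrC lerD2r (le_trans (ler_norm _)) // normrM (gtr0_norm b_gt0).
have be : b * (`|K| + 1) <= e by rewrite -ler_pdivlMr // ge_min lexx orbT.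
by nra.
Qed.

(** By the mean value theorem: the derivative of [f], which is -exp(-t) t^2 / 2, lies between -x^2 /
    2 and 0 on [0, x]. *)
Lemma expR_quadratic_bounds x : 0 <= x ->
  1 - x ^+ 3 / 2 <= expR (- x) * (1 + x + x ^+ 2 / 2) <= 1.
Proof.
move=> x0.
pose f (t : R) := expR (- t) * (1 + t + t ^+ 2 / 2).
pose df (t : R) := - (expR (- t) * (t ^+ 2 / 2)).
have fD (t : R) : is_derive t 1 f (df t).
  by rewrite /f; apply: is_derive_eq; rewrite /df /GRing.scale /=; field.
have cf : {within `[0, x], continuous f}.
  by apply: derivable_within_continuous => u _; exact: ex_derive.
have [c] := MVT_segment x0 (fun t _ => fD t) cf.
rewrite in_itv /= => /andP[c0 cx].
have f0 : f 0 = 1 by rewrite /f oppr0 expR0; ring.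
rewrite f0 subr0 /f /df => fx.
have e0 : 0 < expR (- c) by exact: expR_gt0.
have e1 : expR (- c) <= 1 by rewrite -expR0 ler_expR oppr_le0.
have c2 : 0 <= c ^+ 2 <= x ^+ 2 by rewrite sqr_ge0 lerXn2r.
have xe : expR (- x) * (1 + x + x ^+ 2 / 2) = 1 - expR (- c) * c ^+ 2 * x / 2.
  by move/eqP: fx; rewrite subr_eq => /eqP ->; field.
rewrite xe; case/andP: c2 => c20 c2x.
have : 0 <= expR (- c) * c ^+ 2 <= x ^+ 2 by apply/andP; split; nra.
by case/andP => ? ?; apply/andP; split; nra.
Qed.
End ExponentialBounds.

(** * The quadratic equation for the limit of H, with b = 1 - s *)

Section QuadraticEquation.
Variables (R : realType) (alpha q : R) (h : R -> R).
Hypotheses (alpha_ge0 : 0 <= alpha) (q_ge0 : 0 <= q).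
Hypothesis h01 : forall s : R, 0 <= s <= 1 -> 0 <= h s <= 1.
Hypothesis h_homo : forall s t : R, 0 <= s -> s <= t -> t <= 1 -> h s <= h t.
Hypothesis h0_gt0 : 0 < h 0.
Hypothesis h_quadratic : forall b : R, 0 <= b <= 1 ->
  (h (1 - b) - (1 - b)) ^+ 2 =
  (1 - b) ^+ 2 - expR (- (alpha * b)) * (1 - b - b * q).
(** The coefficient of b^2 in the right-hand side of [h_quadratic] when q = 1 - alpha; the lower
    coefficients then vanish. *)
Let c2 := (alpha ^+ 2 - 4 * alpha + 2) / 2.

(** For these [b] the factor of the exponential in [h_quadratic] is nonnegative, so bounds on the
    exponential can be multiplied by it. *)
Let b_q (b : R) : 0 < b -> b <= (1 + q)^-1 -> [/\ b <= 1, 0 <= b & b + b * q <= 1].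
Proof.
move=> b0 bq; split; [|exact: ltW|by rewrite -{1}[b]mulr1 -mulrDr -ler_pdivlMr ?div1r // ltr_wpDr].
by rewrite (le_trans bq) // invf_le1 ?lerDl // ltr_wpDr.
Qed.

Let iq_gt0 : 0 < (1 + q)^-1.
Proof. by rewrite invr_gt0 ltr_wpDr. Qed.

(** First order of the nonnegative square: by exp(-x) >= 1 - x it is at most b (q + alpha - 1) + b^2
    (1 - alpha (1 + q)). *)
Lemma prob_empty_ge : 1 - alpha <= q.
Proof.
apply: (@le_affine_small _ _ _ (1 - alpha * (1 + q)) _ iq_gt0) => b b0 bq.
have [b1 b0' bq1] := b_q b0 bq.
have : 0 <= (1 - b) ^+ 2 - expR (- (alpha * b)) * (1 - b - b * q).
  by rewrite -h_quadratic ?sqr_ge0 // b0'.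
have := expR_ge1Dx (- (alpha * b)).
set E := expR _ => E1 quad.
rewrite -subr_ge0 -(pmulr_rge0 _ b0).
nra.
Qed.

(** The factor [1 + alpha * b] is at most exp(alpha b) and so absorbs the exponential, leaving a
    polynomial. *)
Lemma excess_le b : 0 < b -> b <= (1 + q)^-1 ->
  b * (alpha + q - 1) - 2 * alpha * b ^+ 2 <=
  (h (1 - b) - (1 - b)) ^+ 2 * (1 + alpha * b).
Proof.
move=> b0 bq; have [b1 b0' bq1] := b_q b0 bq.
rewrite h_quadratic ?b0' //.
have := expR_ge1Dx (alpha * b); have := expRxMexpNx_1 (alpha * b).
have := expR_gt0 (- (alpha * b)).
set E := expR (- _); set E' := expR _ => E0 EE' E'1.
have EE : E * (1 + alpha * b) <= 1 by nra.
have ab : 0 <= alpha * b by rewrite mulr_ge0.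
have ab3 : 0 <= alpha * b ^+ 3 by rewrite mulr_ge0 // exprn_ge0.
have : E * (1 + alpha * b) * (1 - b - b * q) <= 1 - b - b * q.
  by rewrite ler_piMl //; lra.
nra.
Qed.

(** Between the diagonal and 1 the square would be at most b^2, whereas [excess_le] makes it of
    order b. *)
Lemma overload_near1 : q != 1 - alpha ->
  exists2 b0, 0 < b0 <= 1 & forall b : R, 0 < b -> b <= b0 -> h (1 - b) < 1 - b.
Proof.
move=> qa; have e0 : 0 < alpha + q - 1.
  by have := prob_empty_ge; rewrite le_eqVlt eq_sym (negbTE qa) /=; lra.
have a0 : 0 < 2 * (1 + 3 * alpha) by have := alpha_ge0; lra.
(* The two estimates would give alpha + q - 1 <= b (1 + 3 alpha), with 1 + 3 alpha = (1 + alpha) + 2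
   alpha; the factor 2 makes this impossible. *)
exists (Num.min (1 + q)^-1 ((alpha + q - 1) / (2 * (1 + 3 * alpha)))).
  rewrite lt_min iq_gt0 divr_gt0 //= ge_min.
  by rewrite invf_le1 ?lerDl ?q_ge0 // ltr_wpDr.
move=> b b0; rewrite le_min => /andP[bq]; rewrite ler_pdivlMr // => ba.
have [b1 b0' bq1] := b_q b0 bq.
rewrite ltNge; apply/negP => hs.
have /andP[_ h1] : 0 <= h (1 - b) <= 1 by apply: h01; lra.
have hb2 : (h (1 - b) - (1 - b)) ^+ 2 <= b ^+ 2.
  by rewrite lerXn2r // ?nnegrE ?subr_ge0 //; lra.
have := excess_le b0 bq.
have ab : 0 <= alpha * b by rewrite mulr_ge0.
have : (h (1 - b) - (1 - b)) ^+ 2 * (1 + alpha * b) <= b ^+ 2 * (1 + alpha).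
  apply: ler_pM => //; first exact: sqr_ge0.
    by rewrite addr_ge0.
  by rewrite lerD2l ler_piMr // ltW.
nra.
Qed.

(** Multiplying by [X], which is at least 1, turns the exponential into the product bounded below in
    [expR_quadratic_bounds]. The bound on [b] keeps 1 - (2 - alpha) b nonnegative. *)
Lemma gap_le : q = 1 - alpha -> forall b : R, 0 < b -> b <= 2^-1 ->
  (h (1 - b) - (1 - b)) ^+ 2 <=
  b ^+ 2 * (c2 + (alpha + alpha ^+ 2 / 2 + alpha ^+ 3 / 2) * b).
Proof.
move=> qE b b0 b1.
have a0 := alpha_ge0.
have a1 : alpha <= 1 by move: q_ge0; rewrite qE subr_ge0.
have ab : 0 <= alpha * b by rewrite mulr_ge0 // ltW.
have /andP[+ _] := expR_quadratic_bounds ab.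
have := @h_quadratic b.
set d := (h _ - _) ^+ 2; set E := expR _.
have d0 : 0 <= d by exact: sqr_ge0.
have b01 : 0 <= b <= 1 by lra.
move=> /(_ b01) dE.
set X := 1 + _ + _ => EX.
have X1 : 1 <= X by rewrite /X -addrA lerDl addr_ge0 // divr_ge0 // sqr_ge0.
have dX : d <= d * X by rewrite ler_peMr.
apply: (le_trans dX).
have w0 : 0 <= 1 - (2 - alpha) * b by nra.
have w1 : 1 - (2 - alpha) * b <= 1 by nra.
have ab3 : 0 <= (alpha * b) ^+ 3 / 2 by rewrite divr_ge0 // exprn_ge0.
have EXw : (1 - (alpha * b) ^+ 3 / 2) * (1 - (2 - alpha) * b) <=
    E * X * (1 - (2 - alpha) * b) by rewrite ler_wpM2r.
have abw : (alpha * b) ^+ 3 / 2 * (1 - (2 - alpha) * b) <= (alpha * b) ^+ 3 / 2.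
  by rewrite ler_piMr.
have dXE : d * X = (1 - b) ^+ 2 * X - E * X * (1 - (2 - alpha) * b).
  by rewrite dE qE; ring.
have b4 : b ^+ 4 <= b ^+ 3 by rewrite ler_wiXn2l //; lra.
have ab4 : alpha ^+ 2 / 2 * b ^+ 4 <= alpha ^+ 2 / 2 * b ^+ 3.
  by rewrite ler_wpM2l // divr_ge0 // sqr_ge0.
have ab2 : 0 <= alpha ^+ 2 * b ^+ 3.
  by rewrite mulr_ge0 ?sqr_ge0 // exprn_ge0 // ltW.
rewrite dXE /c2; move: EXw abw; rewrite /X; set EX' := E * _ * _.
lra.
Qed.

(** Divide [gap_le] by b^2 and let b tend to 0. *)
Lemma disc_ge0 : q = 1 - alpha -> 0 <= c2.
Proof.
move=> qE; pose C := alpha + alpha ^+ 2 / 2 + alpha ^+ 3 / 2.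
apply: (@le_affine_small _ _ _ C 2^-1) => // b b0 b1.
by rewrite -(pmulr_rge0 _ (exprn_gt0 2 b0)) (le_trans _ (gap_le qE b0 b1)) ?sqr_ge0.
Qed.

Section Subcritical.
Hypotheses (alpha_lt1 : alpha < 1) (c2_ge0 : 0 <= c2).

(** Here exp(-alpha b) times the quadratic Taylor polynomial is at most 1. The first bound separates
    [h] from the diagonal even if [c2] is 0; the second has the sharp leading coefficient at b =
    0. *)
Lemma gap_ge (b : R) : 0 <= b <= 1 ->
  expR (- alpha) * (1 - alpha) * b ^+ 4 <= (h (1 - b) - (1 - b)) ^+ 2 /\
  expR (- (alpha * b)) * c2 * b ^+ 2 <= (h (1 - b) - (1 - b)) ^+ 2.
Proof.
move=> b01; have [b0 b1] := andP b01.
have a0 := alpha_ge0; have a1 := alpha_lt1; have c20 := c2_ge0.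
have ab : 0 <= alpha * b by rewrite mulr_ge0.
have /andP[_] := expR_quadratic_bounds ab.
have E1 : expR (- alpha) <= expR (- (alpha * b)).
  by rewrite ler_expR lerN2 ler_piMr.
have := expR_gt0 (- (alpha * b)).
rewrite h_quadratic //; set X := 1 + _ + _; set E := expR (- (alpha * b)) => E0 EX.
have quad : E * (b ^+ 2 * c2 + b ^+ 3 * (alpha * (1 - alpha)) +
    b ^+ 4 * (alpha ^+ 2 / 2)) <= (1 - b) ^+ 2 - E * (1 - b - b * q).
  apply: (@le_trans _ _ ((1 - b) ^+ 2 * (E * X) - E * (1 - (2 - alpha) * b))).
    by rewrite le_eqVlt; apply/orP; left; apply/eqP; rewrite /X /c2; field.
  apply: lerB; first by rewrite ler_piMr // sqr_ge0.
  by rewrite ler_pM2l //; have := prob_empty_ge; nra.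
have ? : 0 <= alpha * (1 - alpha) by rewrite mulr_ge0 // subr_ge0 ltW.
have ? : 0 <= b ^+ 3 by rewrite exprn_ge0.
have ? : 0 <= b ^+ 4 by rewrite exprn_ge0.
have ? : 0 <= b ^+ 2 by rewrite exprn_ge0.
have ? : 0 <= alpha ^+ 2 / 2 by rewrite divr_ge0 // sqr_ge0.
split; apply: (le_trans _ quad).
  have b42 : b ^+ 4 <= b ^+ 2 by rewrite ler_wiXn2l.
  have b43 : b ^+ 4 <= b ^+ 3 by rewrite ler_wiXn2l.
  apply: (@le_trans _ _ (E * ((1 - alpha) * b ^+ 4))).
    by rewrite [leRHS]mulrA; apply: ler_wpM2r => //; apply: ler_wpM2r => //; lra.
  rewrite ler_pM2l //.
  (* The three coefficients sum to 1 - alpha, and b^2 and b^3 are at least b^4. *)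
  have -> : (1 - alpha) * b ^+ 4 = b ^+ 4 * c2 + b ^+ 4 * (alpha * (1 - alpha)) +
      b ^+ 4 * (alpha ^+ 2 / 2) by rewrite /c2; field.
  by rewrite lerD2r lerD // ler_wpM2r.
rewrite -mulrA ler_pM2l // [c2 * _]mulrC -addrA lerDl.
by rewrite addr_ge0 // mulr_ge0.
Qed.

(* The two solutions of the quadratic equation stay apart on [0, s], and a
   nondecreasing function cannot jump down from the upper to the lower one. *)
Lemma above_diagonal (s : R) : 0 <= s < 1 -> s < h s.
Proof.
move=> /andP[s0 s1].
have a1 := alpha_lt1.
(* The square root of the first bound of [gap_ge] at b = 1 - s, the least value of b on [0, s]. *)
pose kap := Num.sqrt (expR (- alpha) * (1 - alpha)) * (1 - s) ^+ 2.
have kap_gt0 : 0 < kap.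
  rewrite mulr_gt0 ?exprn_gt0 ?subr_gt0 // sqrtr_gt0 mulr_gt0 ?expR_gt0 //.
  by rewrite subr_gt0.
have apart t : 0 <= t -> t <= s -> kap <= `|h t - t|.
  move=> t0 ts; have t01 : 0 <= 1 - t <= 1 by lra.
  have [+ _] := gap_ge t01; rewrite subKr => gap.
  rewrite -ler_sqr ?nnegrE ?(ltW kap_gt0) // real_normK ?num_real //.
  apply: le_trans gap; rewrite exprMn sqr_sqrtr; last first.
    by rewrite mulr_ge0 ?expR_ge0 // subr_ge0 ltW.
  rewrite ler_wpM2l ?mulr_ge0 ?expR_ge0 ?subr_ge0 ?(ltW a1) // -exprM.
  by rewrite lerXn2r ?nnegrE ?subr_ge0 ?lerD2l ?lerN2 //; lra.
(* Advance by steps of length [kap]: from t - kap, where [h] exceeds the diagonal by at least [kap],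
   monotonicity gives h t >= t, and [apart] excludes equality. *)
have up m t : 0 <= t -> t <= s -> t <= m%:R * kap -> t < h t.
  elim: m t => [|m IHm] t t0 ts tm.
    by rewrite (_ : t = 0) //; apply/eqP; rewrite eq_le t0 -(mul0r kap) tm.
  have [tk|kt] := leP t kap.
    have : h 0 <= h t by apply: h_homo => //; lra.
    have := apart 0 (lexx _) s0.
    rewrite subr0 gtr0_norm // => k0 h0t.
    have := apart t t0 ts.
    rewrite lt_neqAle (le_trans tk (le_trans k0 h0t)) andbT eq_sym -subr_eq0 -normr_gt0.
    exact: lt_le_trans.
  have t'0 : 0 <= t - kap by lra.
  have t's : t - kap <= s by lra.
  have : t - kap < h (t - kap).
    by apply: IHm => //; move: tm; rewrite -[m.+1]addn1 natrD mulrDl mul1r; lra.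
  have := apart _ t'0 t's.
  have : h (t - kap) <= h t by apply: h_homo => //; lra.
  move=> hh + ht; rewrite gtr0_norm ?subr_gt0 // => k0.
  have th : t <= h t by lra.
  rewrite lt_neqAle th andbT eq_sym -subr_eq0 -normr_gt0.
  exact: lt_le_trans (apart t t0 ts).
apply: (up (Num.bound (s / kap))) => //.
by rewrite -ler_pdivrMr // ltW // archi_boundP // divr_ge0 // ltW.
Qed.

(** Otherwise [overload_near1] puts [h] below the diagonal near 1, against [above_diagonal]. *)
Lemma prob_emptyE : q = 1 - alpha.
Proof.
apply/eqP; apply/negP => /negP /overload_near1[b0 /andP[b00 b01]].
move=> /(_ b0 b00 (lexx _)); apply/negP; rewrite -leNgt ltW // above_diagonal //.
by rewrite subr_ge0 b01 /= ltrBlDr ltrDl.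
Qed.

End Subcritical.

End QuadraticEquation.

(** * Limits of the recursions for the generating functions *)

Section Recursions.
Import numFieldNormedType.Exports.
(** [F n] and [phi n] stand for the visits to, and the cars leaving, the root of an off-spine
    subtree; [H n] for the visits to a spine vertex from its bush; [g n m] for the overflow of [m]
    spine vertices. *)
Variables (R : realType) (alpha : R) (F phi H : nat -> R -> R).
Variable (g : nat -> nat -> R -> R).
Let E (s : R) := expR (- (alpha * (1 - s))).
Hypothesis alpha_ge0 : 0 <= alpha.
Hypothesis F01 : forall n (s : R), 0 <= s <= 1 -> 0 <= F n s <= 1.
Hypothesis phi01 : forall n (s : R), 0 <= s <= 1 -> 0 <= phi n s <= 1.
Hypothesis H01 : forall n (s : R), 0 <= s <= 1 -> 0 <= H n s <= 1.
Hypothesis g01 : forall n m (s : R), 0 <= s <= 1 -> 0 <= g n m s <= 1.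
Hypothesis F_dec : forall n (s : R), 0 <= s <= 1 -> F n.+1 s <= F n s.
Hypothesis H_dec : forall n (s : R), 0 <= s <= 1 -> H n.+1 s <= H n s.
Hypothesis H_homo : forall n (s t : R), 0 <= s -> s <= t -> t <= 1 ->
  H n s <= H n t.
Hypothesis phi_ge : forall n (s : R), 0 <= s <= 1 -> F n s <= phi n s.
Hypothesis phiE : forall n (s : R), 0 <= s <= 1 ->
  s * phi n s = F n s - (1 - s) * F n 0.
Hypothesis F0E : forall s : R, 0 <= s <= 1 -> F 0 s = 1.
Hypothesis FE : forall n (s : R), 0 <= s <= 1 ->
  F n.+1 s = E s * ((1 + phi n s) / 2) ^+ 2.
Hypothesis H0E : forall s : R, 0 <= s <= 1 -> H 0 s = 1.
Hypothesis HE : forall n (s : R), 0 <= s <= 1 ->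
  H n.+1 s = E s * ((1 + phi n s) / 2).
Hypothesis g0E : forall n (s : R), 0 <= s <= 1 -> g n 0 s = 1.
Hypothesis gE : forall n m (s : R), 0 <= s <= 1 ->
  s * g n m.+1 s = g n m s * H n s - (1 - s) * (g n m 0 * H n 0).
Hypothesis g_ge : forall n m (s : R), 0 <= s <= 1 ->
  g n m s * H n s <= g n m.+1 s.
Hypothesis g_homo : forall n m n' m' (s : R), (n <= n')%N -> (m <= m')%N ->
  0 <= s <= 1 -> g n' m' s <= g n m s.

Let unit0 : 0 <= (0 : R) <= 1. Proof. by rewrite lexx ler01. Qed.

Let E01 (s : R) : 0 <= s <= 1 -> 1 - alpha * (1 - s) <= E s <= 1.
Proof.
move=> /andP[_ s1]; rewrite /E expR_ge1Dx expR_le1 oppr_le0.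
by rewrite mulr_ge0 // subr_ge0.
Qed.

Lemma decreasing_limit (f : nat -> R -> R) :
  (forall n (s : R), 0 <= s <= 1 -> 0 <= f n s) ->
  (forall n (s : R), 0 <= s <= 1 -> f n.+1 s <= f n s) ->
  exists fl : R -> R, forall s : R, 0 <= s <= 1 ->
    f n s @[n --> \oo] --> fl s.
Proof.
move=> f0 fdec; exists (fun s => limn (f ^~ s)) => s s01.
apply: nonincreasing_is_cvgn; first by apply/nonincreasing_seqP => n; exact: fdec.
by exists 0 => _ [n _ <-]; exact: f0.
Qed.

(** Each generation costs at most alpha (1 - s), since ((1 + phi) / 2)^2 >= phi >= F: mean offspring
    one, mean arrivals alpha. *)
Lemma one_sub_F_le n (s : R) : 0 <= s <= 1 -> 1 - F n s <= n%:R * alpha * (1 - s).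
Proof.
move=> s01; elim: n => [|n IHn]; first by rewrite F0E // subrr !mul0r.
have /andP[E0 E1] := E01 s01; have /andP[p0 p1] := phi01 n s01.
have pF := phi_ge n s01.
rewrite FE // -(natr1 n) [leRHS](_ : _ = n%:R * alpha * (1 - s) + alpha * (1 - s)); last by ring.
have E0' : 0 < E s by exact: expR_gt0.
have [] : 1 - (1 - phi n s) <= ((1 + phi n s) / 2) ^+ 2 /\ ((1 + phi n s) / 2) ^+ 2 <= 1.
  by split; nra.
set u := _ ^+ 2 => u1 u2.
have : (1 - E s) * u <= 1 - E s by rewrite ler_piMr // subr_ge0.
lra.
Qed.

Lemma one_sub_H_le n (s : R) : 0 <= s <= 1 -> 1 - H n s <= n%:R * alpha * (1 - s).
Proof.
case: n => [|n] s01; first by rewrite H0E // subrr !mul0r.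
have /andP[E0 E1] := E01 s01; have /andP[p0 p1] := phi01 n s01.
have pF := phi_ge n s01; have Fl := one_sub_F_le n s01.
rewrite HE // -(natr1 n) [leRHS](_ : _ = n%:R * alpha * (1 - s) + alpha * (1 - s)); last by ring.
have : (1 - E s) * ((1 + phi n s) / 2) <= 1 - E s.
  by rewrite ler_piMr ?subr_ge0 //; lra.
lra.
Qed.

(** Each of the [m] spine vertices costs at most n alpha (1 - s), so [g n m] tends to 1 at s = 1 for
    fixed indices. *)
Lemma one_sub_g_le n m (s : R) : 0 <= s <= 1 ->
  1 - g n m s <= m%:R * (n%:R * alpha) * (1 - s).
Proof.
move=> s01; elim: m => [|m IHm]; first by rewrite g0E // subrr !mul0r.
have /andP[H0 H1] := H01 n s01; have /andP[g0 g1] := g01 n m s01.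
have gH := g_ge n m s01; have Hl := one_sub_H_le n s01.
rewrite -(natr1 m) [leRHS](_ : _ = m%:R * (n%:R * alpha) * (1 - s) +
  n%:R * alpha * (1 - s)); last by ring.
have : (1 - H n s) * g n m s <= 1 - H n s by rewrite ler_piMr // subr_ge0.
lra.
Qed.

(** From [gE] and [g n n.+1 <= g n n]; this bounds [g n n 0 * H n 0] from below at each fixed
    [n]. *)
Lemma g_diag_le n (s : R) : 0 <= s <= 1 ->
  g n n s * (H n s - s) <= (1 - s) * (g n n 0 * H n 0).
Proof.
move=> s01; have s0 : 0 <= s by case/andP: s01.
have := gE n n s01.
have : s * g n n.+1 s <= s * g n n s by rewrite ler_wpM2l // g_homo.
lra.
Qed.

(** The limits in n and s are never exchanged: the upper bound takes n to infinity first and then s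
    to 1, the lower bound takes s to 1 at fixed [n] and then n to infinity. *)
Theorem g_diag_cvg : g n n 0 @[n --> \oo] -->
  (if alpha <= 2 - Num.sqrt 2 then expR (alpha / 2) *
     Num.sqrt ((alpha ^+ 2 - 4 * alpha + 2) / (2 * (1 - alpha))) else 0).
Proof.
have a0 := alpha_ge0.
have [Fl Flc] := @decreasing_limit F (fun n s s01 => proj1 (andP (F01 n s01))) F_dec.
have [h hc] := @decreasing_limit H (fun n s s01 => proj1 (andP (H01 n s01))) H_dec.
have [G Gc] := @decreasing_limit (fun n => g n n) (fun n s s01 => proj1 (andP (g01 n n s01)))
  (fun n s s01 => g_homo (leqnSn n) (leqnSn n) s01).
have cvgS (f : nat -> R) (l : R) : f n @[n --> \oo] --> l -> f n.+1 @[n --> \oo] --> l.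
  by rewrite -(cvg_shiftS f).
have lim_le (f : nat -> R) (l c : R) : f n @[n --> \oo] --> l -> (forall n, f n <= c) -> l <= c.
  by move=> fl fc; rewrite -(cvg_lim _ fl) //; apply: limr_le; [exact: (cvgP _ fl)|exact: nearW].
have lim_ge (f : nat -> R) (l c : R) : f n @[n --> \oo] --> l -> (forall n, c <= f n) -> c <= l.
  by move=> fl fc; rewrite -(cvg_lim _ fl) //; apply: limr_ge; [exact: (cvgP _ fl)|exact: nearW].
have lim_eq (f f' : nat -> R) (l l' : R) : f n @[n --> \oo] --> l -> f' n @[n --> \oo] --> l' ->
    f =1 f' -> l = l'.
  by move=> fl fl' /funext ff'; apply: (cvg_unique _ fl); rewrite ?ff'.
have FHl (s : R) : 0 <= s <= 1 -> h s ^+ 2 = E s * Fl s.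
  move=> s01; apply: (lim_eq (fun n => H n.+1 s ^+ 2) (fun n => E s * F n.+1 s)).
  - by rewrite expr2; apply: cvgM; apply: (cvgS (H ^~ s)); exact: hc.
  - by apply: cvgMr; apply: (cvgS (F ^~ s)); exact: Flc.
  - by move=> n; rewrite HE // FE //; ring.
have lim_le2 (f f' : nat -> R) (l l' : R) : f n @[n --> \oo] --> l ->
    f' n @[n --> \oo] --> l' -> (forall n, f n <= f' n) -> l <= l'.
  move=> fl fl' ff'; rewrite -subr_ge0; apply: (lim_ge (fun n => f' n - f n)).
    exact: cvgB.
  by move=> n; rewrite subr_ge0.
have phil (s : R) : 0 <= s <= 1 ->
    2 * s * h s = E s * (s + Fl s - (1 - s) * Fl 0).
  move=> s01; apply: (lim_eq (fun n => 2 * s * H n.+1 s)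
      (fun n => E s * (s + F n s - (1 - s) * F n 0))).
  - by apply: cvgMr; apply: (cvgS (H ^~ s)); exact: hc.
  - apply: cvgMr; apply: cvgB; last by apply: cvgMr; exact: Flc.
    by apply: cvgD; [exact: cvg_cst|exact: Flc].
  - by move=> n; rewrite HE // -addrA -phiE //; field.
(* In [FHl] minus [phil] the unknown [Fl s] cancels; only q = [Fl 0] remains. *)
have h_quad (b : R) : 0 <= b <= 1 -> (h (1 - b) - (1 - b)) ^+ 2 =
    (1 - b) ^+ 2 - expR (- (alpha * b)) * (1 - b - b * Fl 0).
  move=> b01; have s01 : 0 <= 1 - b <= 1 by lra.
  have := phil _ s01; have := FHl _ s01; rewrite /E subKr.
  set e := expR _ => e1 e2.
  rewrite sqrrB e1 -mulr_natl [2%:R * _](_ : _ = 2 * (1 - b) * h (1 - b)); last by ring.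
  by rewrite e2; ring.
have h01 (s : R) : 0 <= s <= 1 -> 0 <= h s <= 1.
  move=> s01; apply/andP; split.
    by apply: (lim_ge (H ^~ s)); [exact: hc|move=> n; case/andP: (H01 n s01)].
  by apply: (lim_le (H ^~ s)); [exact: hc|move=> n; case/andP: (H01 n s01)].
have h_homo (s t : R) : 0 <= s -> s <= t -> t <= 1 -> h s <= h t.
  move=> s0 st t1; apply: (lim_le2 (H ^~ s) (H ^~ t)) => [||n].
  - by apply: hc; lra.
  - by apply: hc; lra.
  - exact: H_homo.
have h0_gt0 : 0 < h 0.
  apply: (@lt_le_trans _ _ (E 0 / 2)); first by rewrite divr_gt0 ?expR_gt0.
  apply: (lim_ge (fun n => H n.+1 0)); first by apply: (cvgS (H ^~ 0)); exact: hc.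
  move=> n; rewrite HE // ler_wpM2l ?expR_ge0 //.
  by have /andP[p0 _] := phi01 n unit0; lra.
have q_ge0 : 0 <= Fl 0.
  by apply: (lim_ge (F ^~ 0)); [exact: Flc|move=> n; case/andP: (F01 n unit0)].
have G01 (s : R) : 0 <= s <= 1 -> 0 <= G s <= 1.
  move=> s01; apply/andP; split.
    by apply: (lim_ge (fun n => g n n s)); [exact: Gc|move=> n; case/andP: (g01 n n s01)].
  by apply: (lim_le (fun n => g n n s)); [exact: Gc|move=> n; case/andP: (g01 n n s01)].
(* [gE] leads from [g n n] to [g n n.+1]; monotonicity in the first index returns to the diagonal at
   the price of an inequality. *)
have Gle (s : R) : 0 <= s <= 1 -> (1 - s) * (G 0 * h 0) <= G s * (h s - s).
  move=> s01; rewrite mulrBr.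
  apply: (lim_le2 (fun n => (1 - s) * (g n n 0 * H n 0))
     (fun n => g n n s * H n s - g n.+1 n.+1 s * s)) => [||n].
  - by apply: cvgMr; apply: cvgM; [exact: Gc|exact: hc].
  - apply: cvgB; first by apply: cvgM; [exact: Gc|exact: hc].
    by apply: cvgMl; apply: (cvgS (fun n => g n n s)); exact: Gc.
  - have := gE n n s01.
    have : s * g n.+1 n.+1 s <= s * g n n.+1 s.
      by rewrite ler_wpM2l ?g_homo //; case/andP: s01.
    lra.
suff -> : (if alpha <= 2 - Num.sqrt 2 then expR (alpha / 2) *
     Num.sqrt ((alpha ^+ 2 - 4 * alpha + 2) / (2 * (1 - alpha))) else 0) = G 0.
  exact: Gc.
have G00 : 0 <= G 0 by case/andP: (G01 _ unit0).
have sqrt2 : Num.sqrt 2 ^+ 2 = 2 :> R by rewrite sqr_sqrtr.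
have sqrt2_ge0 : 0 <= Num.sqrt 2 :> R by exact: sqrtr_ge0.
case: ifPn => [a_le|]; last first.
  rewrite -ltNge => a_gt.
  (* Equality would give alpha <= 1 and a nonnegative quadratic, whose roots are 2 - sqrt 2 and 2 +
     sqrt 2. So [h] lies below the diagonal somewhere, where [Gle] forces G 0 = 0. *)
  have : Fl 0 != 1 - alpha.
    apply/eqP => qE; have := disc_ge0 alpha_ge0 q_ge0 h_quad qE.
    have : alpha <= 1 by move: q_ge0; rewrite qE subr_ge0.
    by nra.
  move=> /(overload_near1 alpha_ge0 q_ge0 h01 h_quad)[b /andP[b0 b1] /(_ b b0 (lexx b))].
  move=> hlt; have s01 : 0 <= 1 - b <= 1 by lra.
  have /andP[Gs _] := G01 _ s01.
  have := Gle _ s01; rewrite subKr => Gb.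
  have : b * (G 0 * h 0) <= 0.
    by apply: (le_trans Gb); rewrite mulr_ge0_le0 // subr_le0 ltW.
  rewrite pmulr_rle0 // pmulr_lle0 // => G0_le.
  by apply/eqP; rewrite eq_le G00 G0_le.
have a_lt1 : alpha < 1 by nra.
have c2_ge0 : 0 <= (alpha ^+ 2 - 4 * alpha + 2) / 2 by nra.
have qE := prob_emptyE alpha_ge0 q_ge0 h01 h_homo h0_gt0 h_quad a_lt1 c2_ge0.
have above := above_diagonal alpha_ge0 q_ge0 h_homo h0_gt0 h_quad a_lt1 c2_ge0.
set c2 := (_ / 2) in c2_ge0.
(* [Gle] with G s <= 1, squared and compared with [gap_le]. *)
have upper : (G 0 * h 0) ^+ 2 <= c2.
  have := gap_le alpha_ge0 q_ge0 h_quad qE; rewrite -/c2; set K := alpha + _ + _ => gap.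
  apply: (@le_affine_small _ _ _ K 2^-1) => // b b0 b1.
  have s01 : 0 <= 1 - b <= 1 by lra.
  have s01' : 0 <= 1 - b < 1 by lra.
  rewrite -(ler_pM2l (exprn_gt0 2 b0)); apply: le_trans (gap b b0 b1).
  rewrite -exprMn lerXn2r ?nnegrE ?subr_ge0 ?(ltW (above _ s01')) //.
    by rewrite !mulr_ge0 // ltW.
  have := Gle _ s01; rewrite subKr => Gb; apply: (le_trans Gb).
  by rewrite ler_piMl ?subr_ge0 ?(ltW (above _ s01')) //; case/andP: (G01 _ s01).
have lower : Num.sqrt c2 <= G 0 * h 0.
  apply: (lim_ge (fun n => g n n 0 * H n 0)); first by apply: cvgM; [exact: Gc|exact: hc].
  move=> n.
  pose C := n%:R * (n%:R * alpha).
  have C0 : 0 <= C by rewrite !mulr_ge0.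
  (* The error comes from (1 - C b) (1 - alpha b) >= 1 - (C + alpha) b; the range of [b] keeps both
     factors nonnegative and b <= 1. *)
  apply: (@le_affine_small _ _ _ (Num.sqrt c2 * (C + alpha)) ((1 + C + alpha)^-1)).
    by rewrite invr_gt0 -addrA ltr_pwDl // addr_ge0.
  move=> b b0; rewrite -[_^-1]mul1r ler_pdivlMr; last by rewrite -addrA ltr_pwDl // addr_ge0.
  move=> bC.
  have b1 : b <= 1.
    by apply: le_trans bC; rewrite ler_peMr ?(ltW b0) //; lra.
  have s01 : 0 <= 1 - b <= 1 by lra.
  have s01' : 0 <= 1 - b < 1 by lra.
  have := g_diag_le n s01; rewrite subKr => gle.
  have b01 : 0 <= b <= 1 by lra.
  have [_] := gap_ge alpha_ge0 q_ge0 h_quad a_lt1 c2_ge0 b01.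
  rewrite -/c2 => gap.
  have /andP[ea _] := E01 s01; rewrite /E subKr in ea.
  have ab0 : 0 <= 1 - alpha * b by nra.
  have ab1 : 1 - alpha * b <= 1 by nra.
  (* After squaring, this is [gap_ge] with exp(-alpha b) >= 1 - alpha b >= (1 - alpha b)^2. *)
  have hs : (1 - alpha * b) * Num.sqrt c2 * b <= h (1 - b) - (1 - b).
    rewrite -ler_sqr ?nnegrE ?subr_ge0 ?(ltW (above _ s01')) //; last first.
      by rewrite !mulr_ge0 ?sqrtr_ge0 // ltW.
    apply: le_trans gap; rewrite !exprMn sqr_sqrtr // ler_wpM2r ?sqr_ge0 //.
    rewrite ler_wpM2r //; apply: le_trans ea.
    by rewrite expr2 ler_piMl.
  have := one_sub_g_le n n s01; rewrite subKr -/C => gC.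
  have hH : h (1 - b) <= H n (1 - b).
    by apply: (@lim_le (fun k => H (k + n)%N (1 - b))); [
      rewrite (cvg_shiftn n (H ^~ (1 - b))); exact: hc
    | move=> k; elim: k => [|k IHk] //; rewrite addSn (le_trans (H_dec _ s01))].
  have /andP[gn0 _] := g01 n n s01.
  set s2 := Num.sqrt c2 in hs *.
  have s20 : 0 <= s2 by exact: sqrtr_ge0.
  have step1 : (1 - C * b) * ((1 - alpha * b) * s2 * b) <= g n n (1 - b) * (H n (1 - b) - (1 - b)).
    apply: ler_pM.
    - by nra.
    - by rewrite !mulr_ge0 // ltW.
    - by lra.
    - by apply: (le_trans hs); rewrite lerD2r.
  have := le_trans step1 gle.
  rewrite (_ : _ * (_ * _ * b) = b * ((1 - C * b) * (1 - alpha * b) * s2)); last by ring.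
  rewrite ler_pM2l // => fin.
  have Cab : 0 <= s2 * (C * alpha * b ^+ 2).
    by rewrite !mulr_ge0 // ltW.
  by nra.
(* At s = 0, [FHl] reads h(0)^2 = exp(-alpha) q. *)
have h0E : h 0 = Num.sqrt (expR (- alpha) * (1 - alpha)).
  have := FHl 0 unit0; rewrite /E subr0 mulr1 qE => <-.
  by rewrite sqrtr_sqr ger0_norm // ltW.
have Gh : G 0 * h 0 = Num.sqrt c2.
  apply/eqP; rewrite eq_le lower andbT -(ler_sqr) ?nnegrE ?sqrtr_ge0 ?mulr_ge0 ?(ltW h0_gt0) //.
  by rewrite sqr_sqrtr.
apply: (mulIf (lt0r_neq0 h0_gt0)); rewrite Gh h0E.
have aE : expR (alpha / 2) = Num.sqrt (expR alpha).
  rewrite [in RHS](_ : alpha = 2%:R * (alpha / 2)); last by field.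
  by rewrite expRM_natl sqrtr_sqr ger0_norm ?expR_ge0.
have x0 : 0 <= (alpha ^+ 2 - 4 * alpha + 2) / (2 * (1 - alpha)).
  by rewrite divr_ge0 //; nra.
rewrite aE -!sqrtrM ?expR_ge0 //; last by rewrite mulr_ge0 ?expR_ge0.
congr Num.sqrt; rewrite expRN /c2.
have : expR alpha != 0 by rewrite gt_eqF ?expR_gt0.
have : 1 - alpha != 0 by rewrite subr_eq0 gt_eqF.
by move=> ? ?; field; apply/andP.
Qed.

End Recursions.

(** * Expectations of functions of independent coordinates *)

Section DependsOn.
Variable I : eqType.
Implicit Types Q : pred I.

(** Only finitely many coordinates matter, and all lie in [Q]: measurability then reduces to
    countably many cylinders, and disjoint [Q] give independence. *)
Definition depends_on (T : Type) Q (f : (I -> nat) -> T) :=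
  exists2 J : seq I, all Q J & forall y z, {in J, y =1 z} -> f y = f z.

Lemma depends_on_cst (T : Type) Q (t : T) : depends_on Q (fun=> t).
Proof. by exists [::]. Qed.

Lemma depends_on_coord Q i : Q i -> depends_on Q (fun y => y i).
Proof.
by move=> Qi; exists [:: i] => [|y z ->]; rewrite /= ?Qi // mem_head.
Qed.

Lemma depends_on_comp (T T' : Type) Q (u : T -> T') f :
  depends_on Q f -> depends_on Q (fun y => u (f y)).
Proof. by case=> J QJ fJ; exists J => // y z /fJ ->. Qed.

Lemma depends_on_comp2 (T T' T'' : Type) Q (u : T -> T' -> T'') f f' :
  depends_on Q f -> depends_on Q f' -> depends_on Q (fun y => u (f y) (f' y)).
Proof.
move=> [J QJ fJ] [J' QJ' fJ']; exists (J ++ J'); first by rewrite all_cat QJ.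
move=> y z yz; rewrite (fJ y z) ?(fJ' y z) // => i iJ;
by apply: yz; rewrite mem_cat iJ ?orbT.
Qed.

Lemma depends_on_sub (T : Type) Q Q' (f : (I -> nat) -> T) :
  (forall i, Q i -> Q' i) -> depends_on Q f -> depends_on Q' f.
Proof. by move=> QQ' [J QJ fJ]; exists J => //; apply: sub_all QJ. Qed.

End DependsOn.

Section Expectation.
Variables (R : realType) (d : measure_display) (Omega : measurableType d).
Variables (P : probability Omega R) (I : eqType) (Y : I -> {RV P >-> nat}).
Hypothesis indepY : mutually_independent Y.

(** Finitely many natural numbers are coded by one, so that integrals become series over codes. *)
Definition encode (J : seq I) (y : I -> nat) : nat := pickle [seq y i | i <- J].

Definition decode (J : seq I) (n : nat) (i : I) : nat :=
  nth 0%N (odflt [::] (unpickle n)) (index i J).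

Lemma encodeK J y : {in J, decode J (encode J y) =1 y}.
Proof.
move=> i iJ; rewrite /decode pickleK /= (nth_map i) ?index_mem //.
by rewrite nth_index.
Qed.

Let fiber (J : seq I) (n : nat) : set Omega := [set w | encode J (Y^~ w) = n].

Let cylinder (J : seq I) (y : I -> nat) := \bigcap_(i in [set` J]) (Y i @^-1` [set y i]).

(** The empty case covers the codes that no outcome attains. *)
Let fiberE J n : fiber J n = cylinder J (decode J n) \/ fiber J n = set0.
Proof.
have [->|/set0P[w0 w0n]] := eqVneq (fiber J n) set0; [by right|left].
apply/seteqP; split=> w /=.
  by rewrite /fiber /= => <- i /= iJ; rewrite encodeK.
rewrite -w0n => wy; rewrite /fiber /=; congr pickle.
by apply/eq_in_map => i iJ; rewrite (wy i iJ) encodeK.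
Qed.

Let measurable_fiber J n : measurable (fiber J n).
Proof.
have [->|-> //] := fiberE J n.
apply: fin_bigcap_measurable => [|i _]; first exact: finite_seq.
by rewrite -[X in measurable X]setTI; exact: measurable_funP.
Qed.

Let fiber_indep J J' n n' : uniq J -> uniq J' ->
  (forall i, i \in J -> i \notin J') ->
  P (fiber J n `&` fiber J' n') = (P (fiber J n) * P (fiber J' n'))%E.
Proof.
move=> uJ uJ' JJ'; have [->|->] := fiberE J n; last by rewrite set0I measure0 mul0e.
have [->|->] := fiberE J' n'; last by rewrite setI0 measure0 mule0.
pose y i := if i \in J then decode J n i else decode J' n' i.
have cyl (J0 : seq I) z : uniq J0 ->
    P (cylinder J0 z) = (\prod_(i <- J0) P (Y i @^-1` [set z i]))%E.
  by move=> uJ0; exact: (indepY uJ0).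
have -> : cylinder J (decode J n) `&` cylinder J' (decode J' n') = cylinder (J ++ J') y.
  apply/seteqP; split=> [w [wJ wJ'] i /=|w wy].
    rewrite mem_cat /y; case: ifPn => [iJ _|iJ /= iJ']; first exact: wJ.
    exact: wJ'.
  split=> i /= iJ.
    by have /= := wy i; rewrite /y mem_cat iJ /=; apply.
  have iJ0 : (i \in J) = false by apply/negbTE; apply/negP => /JJ'; rewrite iJ.
  by have /= := wy i; rewrite /y mem_cat iJ0 iJ /=; apply.
rewrite !cyl ?cat_uniq ?uJ ?uJ' //=; last first.
  by rewrite andbT; apply/hasPn => i iJ'; apply/negP => /JJ'; rewrite iJ'.
rewrite big_cat /=; congr (_ * _)%E; apply: eq_big_seq => i iJ.
  by rewrite /y iJ.
by rewrite /y ifF //; apply/negbTE; apply/negP => /JJ'; rewrite iJ.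
Qed.

Let fiber_cover J (A : set Omega) : \bigcup_n (A `&` fiber J n) = A.
Proof.
by rewrite -setI_bigcupr (_ : \bigcup_n _ = setT) ?setIT // -subTset => w _; exists (encode J (Y^~ w)).
Qed.

Let fiber_trivIset J (A : set Omega) : trivIset setT (fun n => A `&` fiber J n).
Proof. by move=> i j _ _ [w [[_ <-] [_ <-]]]. Qed.

(** [f] is constant on each fiber, so every preimage is a countable union of fibers. *)
Let measurable_depends (f : (I -> nat) -> R) : depends_on predT f ->
  measurable_fun setT (fun w => f (Y^~ w)).
Proof.
move=> [J _ fJ] _ B mB; rewrite setTI.
rewrite -[X in measurable X](fiber_cover J); apply: bigcupT_measurable => n.
set C := (X in measurable X).
have [->|/set0P[w0 [w0B w0n]]] := eqVneq C set0; first by [].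
rewrite (_ : C = fiber J n) //; apply/seteqP; split => [w []//|w wn].
split => //; rewrite /preimage /= (fJ _ (Y^~ w0)) // => i iJ.
by rewrite -(encodeK (Y^~ w) iJ) -(encodeK (Y^~ w0) iJ) (w0n : encode _ _ = n) (wn : encode _ _ = n).
Qed.

Definition unit_valued (f : (I -> nat) -> R) := forall y, 0 <= f y <= 1.

Definition expect (f : (I -> nat) -> R) : R := \int[P]_w f (Y^~ w).

Let integrable_depends (f : (I -> nat) -> R) : depends_on predT f ->
  unit_valued f -> P.-integrable setT (fun w => (f (Y^~ w))%:E).
Proof.
move=> df f01.
have bf : [bounded f (Y^~ w) | w in [set: Omega]].
  exists 1; split => // M M1 w _ /=.
  by have /andP[f0 f1] := f01 (Y^~ w); rewrite ger0_norm // (le_trans f1) // ltW.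
have PT : (P [set: Omega] < +oo)%E by rewrite probability_setT ltry.
exact: (measurable_bounded_integrable measurableT PT (measurable_depends df) bf).
Qed.

Lemma expect_cst (c : R) : expect (fun=> c) = c.
Proof.
have PT : c * fine (P [set: Omega]) = c by rewrite probability_setT mulr1.
by rewrite -[RHS]PT; exact: (Rintegral_cst P measurableT c).
Qed.

Lemma expect_eq f f' : f =1 f' -> expect f = expect f'.
Proof. by move=> ff'; apply: eq_Rintegral => w _; rewrite ff'. Qed.

Lemma expect_le f f' : depends_on predT f -> depends_on predT f' ->
  unit_valued f -> unit_valued f' -> (forall y, f y <= f' y) ->
  expect f <= expect f'.
Proof. by move=> *; apply: le_Rintegral => //; apply: integrable_depends. Qed.

Lemma expect_unit f : depends_on predT f -> unit_valued f -> 0 <= expect f <= 1.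
Proof.
move=> df f01; apply/andP; split.
  by apply: Rintegral_ge0 => w _; case/andP: (f01 (Y^~ w)).
rewrite -[leRHS](expect_cst 1); apply: expect_le => // [|y|y].
- exact: depends_on_cst.
- by rewrite ler01 lexx.
- by case/andP: (f01 y).
Qed.

Lemma expectZ (a : R) f : depends_on predT f -> unit_valued f ->
  expect (fun y => a * f y) = a * expect f.
Proof. by move=> df f01; apply: RintegralZl => //; exact: integrable_depends. Qed.

Lemma expectD f f' : depends_on predT f -> depends_on predT f' ->
  unit_valued f -> unit_valued f' ->
  expect (fun y => f y + f' y) = expect f + expect f'.
Proof. by move=> *; apply: RintegralD => //; apply: integrable_depends. Qed.

Lemma measurable_event (b : (I -> nat) -> bool) : depends_on predT b ->
  measurable [set w | b (Y^~ w)].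
Proof.
move=> db; have := measurable_depends (depends_on_comp (fun c : bool => c%:R : R) db).
move=> /(_ measurableT [set 1] (measurable_set1 _)); rewrite setTI.
rewrite (_ : _ @^-1` _ = [set w | b (Y^~ w)]) //.
apply/seteqP; split=> w /=; first by case: (b _) => // /esym/eqP; rewrite oner_eq0.
by move=> ->.
Qed.

Lemma expect_event (b : (I -> nat) -> bool) : depends_on predT b ->
  (expect (fun y => (b y)%:R))%:E = P [set w | b (Y^~ w)].
Proof.
move=> db; have mb := measurable_event db.
have intb : (\int[P]_w ((b (Y^~ w))%:R)%:E = P [set w | b (Y^~ w)])%E.
  rewrite -[X in P X]setIT -integral_indic //; apply: eq_integral => w _.
  by rewrite indicE mem_setE.
by rewrite /expect /Rintegral intb fineK // fin_num_measure.
Qed.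

Lemma expect_coord (u : nat -> R) i : (forall n, 0 <= u n <= 1) ->
  (expect (fun y => u (y i)))%:E =
  (\sum_(n <oo) (u n)%:E * distribution P (Y i) [set n])%E.
Proof.
move=> u01.
have du : depends_on predT (fun y => u (y i)).
  exact/(depends_on_comp u)/depends_on_coord.
have uu : unit_valued (fun y => u (y i)) by move=> y; exact: u01.
have mY n : measurable (Y i @^-1` [set n]).
  by rewrite -[X in measurable X]setTI; exact: measurable_funP.
have cov : \bigcup_n (Y i @^-1` [set n]) = setT.
  by rewrite -subTset => w _; exists (Y i w).
rewrite /expect /Rintegral fineK; last exact: (integrable_fin_num measurableT (integrable_depends du uu)).
rewrite -cov ge0_integral_bigcup //.
- apply: eq_eseriesr => n _.
  transitivity (\int[P]_(w in Y i @^-1` [set n]) (cst (u n)%:E w))%E.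
    by apply: eq_integral => w; rewrite inE /= => ->.
  by rewrite integral_cst.
- by rewrite cov; apply/measurable_EFinP; exact: (measurable_depends du).
- by move=> w _; rewrite lee_fin; case/andP: (u01 (Y i w)).
- by move=> m n _ _ [w [/= <- <-]].
Qed.

Lemma expect_pmf i n :
  (expect (fun y => (y i == n)%:R))%:E = distribution P (Y i) [set n].
Proof.
rewrite expect_event; last exact/(depends_on_comp (eq_op^~ n))/depends_on_coord.
by congr (P _); apply/seteqP; split => w /= /eqP.
Qed.

Let integral_fibers J (A : set Omega) (u : nat -> R) : measurable A ->
  (forall n, 0 <= u n) ->
  (\int[P]_(w in A) (u (encode J (Y^~ w)))%:E =
   \sum_(n <oo) (u n)%:E * P (A `&` fiber J n))%E.
Proof.
move=> mA u0; rewrite -[in LHS](fiber_cover J A) ge0_integral_bigcup //.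
- apply: eq_eseriesr => n _; rewrite -integral_cst; last exact: measurableI.
  by apply: eq_integral => w; rewrite inE => -[_ <-].
- by move=> n; exact: measurableI.
- rewrite fiber_cover; apply/measurable_EFinP; apply: measurable_funTS.
  apply: (@measurable_depends (fun y => u (encode J y))).
  by exists J => [|y z yz]; [exact/allP|rewrite /encode; congr (u (pickle _)); apply/eq_in_map].
- by move=> w _; rewrite lee_fin.
Qed.

(** Both expectations are series over the codes of their coordinates, and [fiber_indep] factors each
    joint term. *)
Lemma expectM (Q Q' : pred I) f f' : (forall i, Q i -> ~~ Q' i) ->
  depends_on Q f -> depends_on Q' f' -> unit_valued f -> unit_valued f' ->
  expect (fun y => f y * f' y) = expect f * expect f'.
Proof.
move=> QQ' [J0 QJ fJ] [J0' QJ' fJ'] f01 f01'.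
(* [mutually_independent] speaks of lists without repetition. *)
pose J := undup J0; pose J' := undup J0'.
have codeE (T : Type) (J1 : seq I) (k : (I -> nat) -> T) w :
    (forall y z, {in J1, y =1 z} -> k y = k z) ->
    k (Y^~ w) = k (decode (undup J1) (encode (undup J1) (Y^~ w))).
  by move=> kJ; apply: kJ => i iJ; rewrite encodeK // mem_undup.
have JJ' i : i \in J -> i \notin J'.
  rewrite !mem_undup => /(allP QJ) /QQ' nQ'; apply/negP => /(allP QJ').
  by rewrite (negbTE nQ').
pose u n := f (decode J n); pose u' n := f' (decode J' n).
have u0 n : 0 <= u n by case/andP: (f01 (decode J n)).
have u0' n : 0 <= u' n by case/andP: (f01' (decode J' n)).
have intf' A : measurable A -> (\int[P]_(w in A) (f' (Y^~ w))%:E =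
    \sum_(n <oo) (u' n)%:E * P (A `&` fiber J' n))%E.
  by move=> mA; rewrite -integral_fibers //; apply: eq_integral => w _; rewrite (codeE _ _ _ w fJ').
have intf : (\int[P]_w (f (Y^~ w))%:E = \sum_(n <oo) (u n)%:E * P (fiber J n))%E.
  transitivity (\int[P]_w (u (encode J (Y^~ w)))%:E)%E.
    by apply: eq_integral => w _; rewrite (codeE _ _ _ w fJ).
  by rewrite integral_fibers //; apply: eq_eseriesr => n _; rewrite setTI.
have df : depends_on predT f by exists J0 => //; exact/allP.
have df' : depends_on predT f' by exists J0' => //; exact/allP.
have df2 := depends_on_comp2 *%R df df'.
rewrite /expect /Rintegral -fineM; last 2 first.
- exact/integrable_fin_num/integrable_depends.
- exact/integrable_fin_num/integrable_depends.
congr fine; rewrite -[in LHS](fiber_cover J setT) ge0_integral_bigcup //; last 3 first.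
- by move=> n; exact: measurableI.
- rewrite fiber_cover; apply/measurable_EFinP; exact: (measurable_depends df2).
- move=> w _; rewrite lee_fin mulr_ge0 //.
    by case/andP: (f01 (Y^~ w)).
  by case/andP: (f01' (Y^~ w)).
have intf'0 : (0 <= \int[P]_w (f' (Y^~ w))%:E)%E.
  by apply: integral_ge0 => w _; rewrite lee_fin; case/andP: (f01' (Y^~ w)).
have intf'fin : (\int[P]_w (f' (Y^~ w))%:E)%E \is a fin_num.
  exact/integrable_fin_num/integrable_depends.
rewrite intf muleC -(fineK intf'fin) -nneseriesZl; last first.
  by move=> n _; rewrite mule_ge0 // lee_fin.
apply: eq_eseriesr => n _; rewrite fineK // setTI.
transitivity ((u n)%:E * \int[P]_(w in fiber J n) (f' (Y^~ w))%:E)%E.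
  rewrite -ge0_integralZl //.
  - apply: eq_integral => w; rewrite inE => wn.
    by rewrite (codeE _ _ _ w fJ) (wn : encode J _ = n).
  - by apply/measurable_EFinP; apply: measurable_funTS; exact: (measurable_depends df').
  - by move=> w _; rewrite lee_fin; case/andP: (f01' (Y^~ w)).
  - by rewrite lee_fin.
rewrite muleCA; congr (_ * _)%E.
rewrite intf' // intf' // muleC -(@fineK _ (P (fiber J n))) ?fin_num_measure //.
rewrite -nneseriesZl; last by move=> m _; rewrite mule_ge0 // lee_fin.
apply: eq_eseriesr => m _; rewrite fineK ?fin_num_measure // setTI.
by rewrite fiber_indep ?undup_uniq // muleCA.
Qed.

End Expectation.

(** * Generating functions *)

Section TreeCoordinates.
Local Notation index := (vertex + vertex)%type.
Implicit Types (y : index -> nat) (h : nat) (w : seq nat).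

(** A configuration [y] packs both families: [inl v] carries the offspring number at [v], [inr v]
    the number of arrivals. *)
Definition visits_of n h w y := visits (y \o inl) (y \o inr) n h w.
Definition overflow_of n m h y := overflow (y \o inl) (y \o inr) n m h.
Definition extinct_of n h w y := extinct (y \o inl) n h w.

Definition label (i : index) : vertex := match i with inl v => v | inr v => v end.

(** The coordinates at (h, w) and its descendants inside the bush of S_h; the spine beyond S_h is
    excluded. *)
Definition subtree h w : pred index :=
  fun i => ((label i).1 == h) && (take (size w) (label i).2 == w).

Lemma subtree_rcons h w j i : subtree h (rcons w j) i -> subtree h w i.
Proof.
rewrite /subtree => /andP[-> /eqP]; rewrite size_rcons /= => tw.
have := congr1 (take (size w)) tw.
by rewrite take_takel // -cats1 take_size_cat // => ->.
Qed.

Lemma subtree_root h w j : subtree h (rcons w j) (inl (h, w)) = false /\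
  subtree h (rcons w j) (inr (h, w)) = false.
Proof.
rewrite /subtree /= size_rcons take_oversize // eqxx /=; split;
by apply/negP => /eqP/(congr1 size)/eqP; rewrite size_rcons -[X in X == _]addn0 -addn1 eqn_add2l.
Qed.

Lemma subtree_sibling h w i : subtree h (rcons w 0) i -> ~~ subtree h (rcons w 1) i.
Proof.
rewrite /subtree !size_rcons => /andP[_ /eqP ->]; rewrite negb_and; apply/orP; right.
by rewrite eqseq_rcons andbF.
Qed.

Lemma subtree_self h w : subtree h w (inl (h, w)) /\ subtree h w (inr (h, w)).
Proof. by rewrite /subtree /= take_size !eqxx. Qed.

Lemma depends_on_visits n h w : depends_on (subtree h w) (visits_of n h w).
Proof.
elim: n w => [|n IHn] w; first exact: depends_on_cst.
have [sl sr] := subtree_self h w.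
pose u (j : nat) (k v : nat) := ((j < k) * v.-1)%N.
have child j : depends_on (subtree h w)
    (fun y => u j (y (inl (h, w))) (visits_of n h (rcons w j) y)).
  apply: depends_on_comp2; first exact: depends_on_coord.
  by apply: depends_on_sub (IHn _) => i; exact: subtree_rcons.
apply: (depends_on_comp2 addn); first exact: depends_on_coord.
by apply: (depends_on_comp2 addn); exact: child.
Qed.

Definition from_level h : pred index := fun i => (h <= (label i).1)%N.

Lemma depends_on_overflow n m h : depends_on (from_level h) (overflow_of n m h).
Proof.
elim: m h => [|m IHm] h; first exact: depends_on_cst.
apply: (depends_on_comp2 (fun a b => (a + b).-1)).
  apply: depends_on_sub (depends_on_visits n h [::]) => i.
  by case/andP => /eqP hi _; rewrite /from_level hi.
by apply: depends_on_sub (IHm h.+1) => i; exact: ltnW.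
Qed.

Lemma depends_on_extinct n h w : depends_on (subtree h w) (extinct_of n h w).
Proof.
elim: n w => [|n IHn] w; first exact: depends_on_cst.
have [sl sr] := subtree_self h w.
pose u (j : nat) (k : nat) (b : bool) := ((j < k)%N ==> b).
have child j : depends_on (subtree h w)
    (fun y => u j (y (inl (h, w))) (extinct_of n h (rcons w j) y)).
  apply: depends_on_comp2; first exact: depends_on_coord.
  by apply: depends_on_sub (IHn _) => i; exact: subtree_rcons.
by apply: (depends_on_comp2 andb); exact: child.
Qed.

Lemma depends_on_in_tree v : depends_on predT (fun y => in_tree (y \o inl) v).
Proof.
case: v => h w; elim/last_ind: w => [|w j IHw]; first exact: depends_on_cst.
rewrite (_ : (fun y => _) = fun y => in_tree (y \o inl) (h, w) && (j < y (inl (h, w)))%N).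
  apply: (depends_on_comp2 andb IHw).
  exact/(depends_on_comp (fun n => j < n)%N)/depends_on_coord.
by apply/funext => y; rewrite in_tree_rcons.
Qed.

Lemma depends_on_lists_arrivals h s v : depends_on predT (fun y =>
  count_mem v s ==
    if (v.1 <= h)%N && in_tree (y \o inl) v then y (inr v) else 0%N).
Proof.
pose u (b : bool) n := count_mem v s == if (v.1 <= h)%N && b then n else 0%N.
apply: (depends_on_comp2 u); first exact: depends_on_in_tree.
exact: depends_on_coord.
Qed.

End TreeCoordinates.

(** * Generating functions under truncation, sums and branching *)

Section Generating.
Variables (R : realType) (d : measure_display) (Omega : measurableType d).
Variables (P : probability Omega R) (I : eqType) (Y : I -> {RV P >-> nat}).
Hypothesis indepY : mutually_independent Y.

Local Notation expect := (expect Y).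
Implicit Types (s : R) (Z : (I -> nat) -> nat).

Lemma unit_valuedX s Z : 0 <= s <= 1 -> unit_valued (fun y => s ^+ Z y).
Proof. by move=> /andP[s0 s1] y; rewrite exprn_ge0 // exprn_ile1. Qed.

Lemma unit_valued_bool (b : (I -> nat) -> bool) : unit_valued (fun y => (b y)%:R : R).
Proof. by move=> y; case: (b y); rewrite lexx ler01. Qed.

Definition pgf Z s : R := expect (fun y => s ^+ Z y).

Lemma pgf_unit Z s : depends_on predT Z -> 0 <= s <= 1 -> 0 <= pgf Z s <= 1.
Proof.
move=> dZ s01; apply: expect_unit; last exact: unit_valuedX.
exact: depends_on_comp.
Qed.

Lemma pgf_homo Z s t : depends_on predT Z -> 0 <= s -> s <= t -> t <= 1 ->
  pgf Z s <= pgf Z t.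
Proof.
move=> dZ s0 st t1; have t0 := le_trans s0 st; have s1 := le_trans st t1.
apply: expect_le => [||||y]; try exact: (depends_on_comp _ dZ).
- by apply: unit_valuedX; rewrite s0.
- by apply: unit_valuedX; rewrite t0.
- by rewrite lerXn2r.
Qed.

Lemma pgf_le Z Z' s : depends_on predT Z -> depends_on predT Z' -> 0 <= s <= 1 ->
  (forall y, Z y <= Z' y)%N -> pgf Z' s <= pgf Z s.
Proof.
move=> dZ dZ' s01 ZZ'; case/andP: (s01) => s0 s1.
apply: expect_le => [||||y]; try exact: depends_on_comp.
- exact: unit_valuedX.
- exact: unit_valuedX.
- by rewrite ler_wiXn2l.
Qed.

(** Pointwise, with [0 ^+ Z] the indicator of Z = 0: s^Z equals s times s^(Z.-1), plus (1 - s)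
    0^Z. *)
Lemma pgf_pred Z s : depends_on predT Z -> 0 <= s <= 1 ->
  s * pgf (fun y => (Z y).-1) s = pgf Z s - (1 - s) * pgf Z 0.
Proof.
move=> dZ s01; have s10 : 0 <= 1 - s <= 1 by lra.
have z01 : 0 <= (0 : R) <= 1 by rewrite lexx ler01.
have dp := depends_on_comp predn dZ.
apply/eqP; rewrite eq_sym subr_eq eq_sym /pgf -!expectZ; last 4 first.
- exact: (depends_on_comp _ dZ).
- exact: unit_valuedX.
- exact: (depends_on_comp _ dp).
- exact: unit_valuedX.
have unitM (a : R) (Z' : (I -> nat) -> nat) (t : R) : 0 <= a <= 1 -> 0 <= t <= 1 ->
    unit_valued (fun y : I -> nat => a * t ^+ Z' y).
  move=> /andP[a0 a1] t01 y; have /andP[t0 t1] := unit_valuedX Z' t01 y.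
  by rewrite mulr_ge0 // mulr_ile1.
rewrite -expectD; last 4 first.
- exact: (depends_on_comp (fun n => s * s ^+ n) dp).
- exact: (depends_on_comp (fun n => (1 - s) * 0 ^+ n) dZ).
- exact: unitM.
- exact: unitM.
apply/eqP/expect_eq => y; case: (Z y) => [|n] /=; first by rewrite !expr0; ring.
by rewrite expr0n mulr0 addr0 exprS.
Qed.

Lemma pgf0_bounds Z s : depends_on predT Z -> 0 <= s <= 1 ->
  pgf Z 0 <= pgf Z s <= pgf Z 0 + s.
Proof.
move=> dZ s01; have /andP[s0 s1] := s01; rewrite pgf_homo //=.
have := pgf_pred dZ s01; have dp := depends_on_comp predn dZ.
have /andP[p0 p1] := pgf_unit dp s01.
have z01 : 0 <= (0 : R) <= 1 by rewrite lexx ler01.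
have /andP[q0 q1] := pgf_unit dZ z01.
have : s * pgf (fun y => (Z y).-1) s <= s by rewrite ler_piMr.
have : 0 <= s * pgf Z 0 by rewrite mulr_ge0.
lra.
Qed.

(** [pgf_pred] determines the generating function of a predecessor only after division by s; the
    value at 0 follows by continuity, from [pgf0_bounds]. *)
Lemma pgf_eq0 Z Z' : depends_on predT Z -> depends_on predT Z' ->
  (forall s, 0 < s <= 1 -> pgf Z s = pgf Z' s) -> pgf Z 0 = pgf Z' 0.
Proof.
move=> dZ dZ' ZZ'.
have half W W' : depends_on predT W -> depends_on predT W' ->
    (forall s, 0 < s <= 1 -> pgf W s = pgf W' s) -> pgf W 0 <= pgf W' 0.
  move=> dW dW' WW'; apply: (@le_affine_small _ _ _ 1 1) => // s s0 s1.
  have s01 : 0 <= s <= 1 by rewrite ltW.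
  have /andP[W0 _] := pgf0_bounds dW s01; have /andP[_ W1] := pgf0_bounds dW' s01.
  by rewrite mul1r (le_trans W0) // WW' ?s0.
by apply/eqP; rewrite eq_le !half // => s s01; rewrite ZZ'.
Qed.

Lemma pgfD (Q Q' : pred I) Z Z' s : (forall i, Q i -> ~~ Q' i) ->
  depends_on Q Z -> depends_on Q' Z' -> 0 <= s <= 1 ->
  pgf (fun y => Z y + Z' y)%N s = pgf Z s * pgf Z' s.
Proof.
move=> QQ' dZ dZ' s01; rewrite /pgf -(expectM indepY QQ').
- by apply: expect_eq => y; rewrite exprD.
- exact: (depends_on_comp _ dZ).
- exact: (depends_on_comp _ dZ').
- exact: unit_valuedX.
- exact: unit_valuedX.
Qed.

(** The contribution of [k] children to the generating function; as in [visits], more than two count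
    as two. *)
Definition branch (k : nat) (a b : R) : R :=
  (k == 0%N)%:R + ((k == 1%N)%:R * a + (1 < k)%:R * (a * b)).

(** The three events for the offspring number are independent of both subtrees, and the last has
    probability 1 - p 0 - p 1. *)
Lemma expect_branch (Q0 Q1 : pred I) i f0 f1 :
  (forall j, Q0 j -> ~~ Q1 j) -> ~~ Q0 i -> ~~ Q1 i ->
  depends_on Q0 f0 -> depends_on Q1 f1 -> unit_valued f0 -> unit_valued f1 ->
  let p n := expect (fun y => (y i == n)%:R) in
  expect (fun y => branch (y i) (f0 y) (f1 y)) =
  p 0%N + p 1%N * expect f0 + (1 - p 0%N - p 1%N) * (expect f0 * expect f1).
Proof.
move=> Q01 Q0i Q1i df0 df1 f01 f11 p.
have di : depends_on (pred1 i) (fun y => y i) by apply: depends_on_coord => /=.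
have dT (T : Type) Q (f : (I -> nat) -> T) : depends_on Q f -> depends_on predT f.
  exact: depends_on_sub.
have db (b : pred nat) : depends_on (pred1 i) (fun y => (b (y i))%:R : R).
  exact: (depends_on_comp (fun n => (b n)%:R) di).
have ub (b : pred nat) : unit_valued (fun y => (b (y i))%:R : R).
  exact: (unit_valued_bool (fun y => b (y i))).
have f2 : unit_valued (fun y => f0 y * f1 y).
  move=> y; have /andP[? ?] := f01 y; have /andP[? ?] := f11 y.
  by rewrite mulr_ge0 // mulr_ile1.
have df2 : depends_on (fun j => Q0 j || Q1 j) (fun y => f0 y * f1 y).
  apply: (depends_on_comp2 *%R).
    by apply: depends_on_sub df0 => j Qj; rewrite Qj.
  by apply: depends_on_sub df1 => j Qj; rewrite Qj orbT.
have ubf (b : pred nat) (f : (I -> nat) -> R) :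
    unit_valued f -> unit_valued (fun y => (b (y i))%:R * f y).
  move=> f0' y; have /andP[? ?] := f0' y; have /andP[? ?] := ub b y.
  by rewrite mulr_ge0 // mulr_ile1.
have dbf (b : pred nat) (f : (I -> nat) -> R) :
    depends_on predT f -> depends_on predT (fun y => (b (y i))%:R * f y).
  by apply: depends_on_comp2; apply: dT (db b).
have d0 := dT _ _ _ (db (pred1 0%N)); have u0 := ub (pred1 0%N).
have d1 := dT _ _ _ (db (pred1 1%N)); have u1 := ub (pred1 1%N).
have d2 := dT _ _ _ (db (fun n => 1 < n)%N); have u2 := ub (fun n => 1 < n)%N.
have -> : 1 - p 0%N - p 1%N = expect (fun y => (1 < y i)%N%:R).
  have ub2 : unit_valued (fun y => (y i == 1%N)%:R + (1 < y i)%N%:R : R).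
    by move=> y; case: (y i) => [|[|n]] /=; rewrite ?add0r ?addr0 ?lexx ?ler01.
  have : p 0%N + (p 1%N + expect (fun y => (1 < y i)%N%:R)) = 1.
    rewrite -(expectD Y d1 d2 u1 u2) -(expectD Y d0 (depends_on_comp2 +%R d1 d2) u0 ub2).
    rewrite -[RHS](expect_cst Y 1); apply: expect_eq => y.
    by case: (y i) => [|[|n]] /=; rewrite ?add0r ?addr0.
  by move=> sum1; rewrite -[X in X - _ - _ = _]sum1; ring.
have ub3 : unit_valued (fun y => (y i == 1%N)%:R * f0 y + (1 < y i)%:R * (f0 y * f1 y)).
  move=> y; have := f01 y; have := f2 y.
  by case: (y i) => [|[|n]] /=; rewrite ?mul0r ?mul1r ?add0r ?addr0 ?lexx ?ler01.
have d1f := dbf (pred1 1%N) _ (dT _ _ _ df0); have u1f := ubf (pred1 1%N) _ f01.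
have d2f := dbf (fun n => 1 < n)%N _ (dT _ _ _ df2).
have u2f := ubf (fun n => 1 < n)%N _ f2.
rewrite (expectD Y d0 (depends_on_comp2 +%R d1f d2f) u0 ub3) (expectD Y d1f d2f u1f u2f).
rewrite -addrA; congr (_ + (_ + _)).
  by apply: (expectM indepY _ (db (pred1 1%N)) df0) => // j /eqP ->.
rewrite -(expectM indepY Q01 df0 df1) //.
apply: (expectM indepY _ (db (fun n => 1 < n)%N) df2) => // j /eqP ->.
by rewrite negb_or Q0i.
Qed.

End Generating.

(** * Kesten's tree with Poisson arrivals *)

Section KestenTree.
Import numFieldNormedType.Exports.
Variables (R : realType) (d : measure_display) (Omega : measurableType d).
Variables (P : probability Omega R) (alpha : R).
Variables K X : vertex -> {RV P >-> nat}.
Hypothesis alpha_ge0 : 0 <= alpha.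
Hypothesis K_spine : forall h i : nat,
  distribution P (K (h, [::])) [set i] = ((i.+1%:R)%:E * nu R [set i.+1])%E.
Hypothesis K_bush : forall (h : nat) (w : seq nat), w <> [::] ->
  forall B : set nat, distribution P (K (h, w)) B = nu R B.
Hypothesis X_law : forall (v : vertex) (B : set nat),
  distribution P (X v) B = Po alpha B.

Definition coordinate (a : vertex + vertex) : {RV P >-> nat} :=
  match a with inl v => K v | inr v => X v end.

Hypothesis KX_indep : mutually_independent coordinate.

Local Notation expect := (expect coordinate).
Local Notation pgf := (pgf coordinate).
Implicit Types (s : R) (n m h : nat) (w : seq nat).
Let E s := expR (- (alpha * (1 - s))).

Lemma depends_onT (T : Type) (Q : pred (vertex + vertex))
  (f : (vertex + vertex -> nat) -> T) : depends_on Q f -> depends_on predT f.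
Proof. exact: depends_on_sub. Qed.

Lemma nu_set1 i : nu R [set i] = ((2^-1 : R) ^+ 2 *+ 'C(2, i))%:E.
Proof.
rewrite /nu /binomial_prob ifT; last by lra.
rewrite esum_set1 ?lee_fin ?binomial_pmf_ge0 //; last by lra.
rewrite (_ : binomial_pmf _ _ _ = 2^-1 ^+ i * (1 - 2^-1) ^+ (2 - i) *+ 'C(2, i)) //.
have -> : 1 - 2^-1 = 2^-1 :> R by field.
case: (leqP i 2) => i2; last by rewrite bin_small // !mulr0n.
by rewrite -exprD subnKC.
Qed.

Lemma offspring_pmf h w : let p i := expect (fun y => (y (inl (h, w)) == i)%:R) in
  if w == [::] then p 0%N = 2^-1 /\ p 1%N = 2^-1
  else p 0%N = 4^-1 /\ p 1%N = 2^-1.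
Proof.
have pE i : expect (fun y => (y (inl (h, w)) == i)%:R) =
    fine (distribution P (K (h, w)) [set i]).
  by rewrite -(expect_pmf coordinate (inl (h, w))).
case: eqP => w0 /=; rewrite !pE.
  by rewrite w0 !K_spine !nu_set1 /= binn bin1; split; field.
by rewrite !(K_bush _ w0) !nu_set1 /= bin0 bin1; split; field.
Qed.

Lemma Po_set1 n : Po alpha [set n] =
  (alpha ^+ n / n`!%:R * expR (- alpha))%:E.
Proof.
rewrite /Po /poisson_prob; case: ifPn => [a0|].
  rewrite esum_set1 ?lee_fin ?poisson_pmf_ge0 //.
  by rewrite /poisson_pmf a0.
rewrite -leNgt => a_le0; have -> : alpha = 0 by apply/eqP; rewrite eq_le a_le0.
rewrite oppr0 expR0 mulr1 diracE; case: n => [|n].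
  by rewrite mem_set // expr0 fact0 divr1.
by rewrite memNset // expr0n mul0r.
Qed.

Lemma pgf_arrivals v s : 0 <= s <= 1 ->
  expect (fun y => s ^+ y (inr v)) = E s.
Proof.
move=> s01; have /andP[s0 s1] := s01.
suff : (expect (fun y => s ^+ y (inr v)))%:E = (E s)%:E by case.
rewrite (@expect_coord _ _ _ _ _ _ (fun n => s ^+ n)); last first.
  by move=> n; rewrite exprn_ge0 // exprn_ile1.
rewrite /E mulrBr mulr1 opprB addrC expRD EFinM.
under eq_eseriesr => n _.
  rewrite [distribution _ _ _](X_law v) Po_set1 -EFinM.
  rewrite [_ * _](_ : _ = expR (- alpha) * ((alpha * s) ^+ n / n`!%:R)).
    by rewrite EFinM; over.
  by rewrite exprMn; ring.
rewrite nneseriesZl; last first.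
  by move=> n _; rewrite lee_fin divr_ge0 // exprn_ge0 // mulr_ge0.
congr *%E; rewrite expRE -EFin_lim; last first.
  rewrite /pseries/=; under eq_fun do rewrite mulrC.
  exact: is_cvg_series_exp_coeff.
apply/congr_lim/funext => n/=; rewrite /pseries/= /series/= -sumEFin//.
by under eq_bigr do rewrite mulrC.
Qed.

Let visits_dep n h w : depends_on predT (visits_of n h w).
Proof. exact: depends_onT (@depends_on_visits n h w). Qed.

Let pvisits_dep n h w : depends_on predT (fun y => (visits_of n h w y).-1).
Proof. exact: (depends_on_comp predn (@visits_dep n h w)). Qed.

Definition pgf_visits n h w s := pgf (visits_of n h w) s.
Definition pgf_flow n h w s := pgf (fun y => (visits_of n h w y).-1) s.

(** The arrivals, the offspring number and the two child subtrees use disjoint coordinates.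
    Offspring masses are 1/2, 1/2 on the spine and 1/4, 1/2, 1/4 off it. *)
Lemma pgf_visitsS n h w s : 0 <= s <= 1 ->
  let a := pgf_flow n h (rcons w 0) s in let b := pgf_flow n h (rcons w 1) s in
  pgf_visits n.+1 h w s =
  E s * (if w == [::] then (1 + a) / 2 else 4^-1 + a / 2 + a * b / 4).
Proof.
move=> s01 a b; pose v := (h, w).
pose Q i := [|| i == inl v, subtree h (rcons w 0) i | subtree h (rcons w 1) i].
pose flow j y := ((j < y (inl v))%N * (visits_of n h (rcons w j) y).-1)%N.
have dflow j : (j < 2)%N -> depends_on Q (flow j).
  move=> j2; apply: (depends_on_comp2 (fun k z => ((j < k)%N * z.-1)%N)).
    by apply: depends_on_coord; rewrite /Q eqxx.
  apply: depends_on_sub (@depends_on_visits n h (rcons w j)) => i; rewrite /Q.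
  by case: j j2 => [|[|//]] _ ->; rewrite !orbT.
have -> : pgf_visits n.+1 h w s = pgf (fun y => y (inr v) + (flow 0 y + flow 1 y))%N s by [].
have [inl0 inr0] := subtree_root h w 0; have [inl1 inr1] := subtree_root h w 1.
rewrite (@pgfD _ _ _ _ _ _ KX_indep (pred1 (inr v)) Q) //; first last.
- by apply: (depends_on_comp2 addn); exact: dflow.
- by apply: depends_on_coord => /=.
- by move=> i /eqP ->; rewrite /Q inr0 inr1.
rewrite -(pgf_arrivals v s01); congr (_ * _).
pose z j (y : vertex + vertex -> nat) := s ^+ (visits_of n h (rcons w j) y).-1.
transitivity (expect (fun y => branch (y (inl v)) (z 0 y) (z 1 y))).
  apply: expect_eq => y; rewrite /flow /branch /z.
  by case: (y (inl v)) => [|[|k]] /=; rewrite ?mul0n ?mul1n ?addn0 ?expr0 ?mul0r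
    ?mul1r ?add0r ?addr0 ?exprD.
have dz j : depends_on (subtree h (rcons w j)) (z j).
  exact: (depends_on_comp (fun k => s ^+ k.-1) (@depends_on_visits n h (rcons w j))).
rewrite (@expect_branch _ _ _ _ _ _ KX_indep _ _ _ _ _ (@subtree_sibling h w)
  _ _ (dz 0) (dz 1)); first last.
- exact: unit_valuedX.
- exact: unit_valuedX.
- by rewrite inl1.
- by rewrite inl0.
have := offspring_pmf h w; rewrite -/v -[expect (z 0)]/a -[expect (z 1)]/b.
by case: eqP => _ [-> ->]; field.
Qed.
Let unit0 : 0 <= (0 : R) <= 1. Proof. by rewrite lexx ler01. Qed.

Lemma pgf_flow_eq n h w h' w' :
  (forall s, 0 <= s <= 1 -> pgf_visits n h w s = pgf_visits n h' w' s) ->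
  forall s, 0 <= s <= 1 -> pgf_flow n h w s = pgf_flow n h' w' s.
Proof.
move=> eqv.
have pos s : 0 < s <= 1 -> pgf_flow n h w s = pgf_flow n h' w' s.
  move=> /andP[s0 s1]; have s01 : 0 <= s <= 1 by rewrite ltW.
  apply: (mulfI (lt0r_neq0 s0)); rewrite !pgf_pred //.
  by have := eqv _ s01; have := eqv _ unit0; rewrite /pgf_visits => -> ->.
move=> s /andP[]; rewrite le_eqVlt => /predU1P[<- _|s0 s1]; last by rewrite pos // s0.
by apply: pgf_eq0 => //; exact: pvisits_dep.
Qed.

(** [pgf_visitsS] distinguishes vertices only by [w == [::]], and children are never on the
    spine. *)
Lemma pgf_visits_bush n h w h' w' : w != [::] -> w' != [::] ->
  forall s, 0 <= s <= 1 -> pgf_visits n h w s = pgf_visits n h' w' s.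
Proof.
have rn (u : seq nat) j : rcons u j != [::] by case: u.
elim: n h w h' w' => [//|n IHn] h w h' w' w0 w0' s s01.
rewrite !pgf_visitsS // (negbTE w0) (negbTE w0').
have eqf j : pgf_flow n h (rcons w j) s = pgf_flow n h' (rcons w' j) s.
  by apply: pgf_flow_eq s01; exact: IHn.
by rewrite !eqf.
Qed.

(** Child 0 of S_0 represents all off-spine vertices, and S_0 all spine vertices. *)
Let F n s := pgf_visits n 0 [:: 0%N] s.
Let phi n s := pgf_flow n 0 [:: 0%N] s.
Let H n s := pgf_visits n 0 [::] s.

Let flow_bush n h w s : w != [::] -> 0 <= s <= 1 -> pgf_flow n h w s = phi n s.
Proof. by move=> w0 s01; apply: pgf_flow_eq s01; exact: pgf_visits_bush. Qed.

Let FS n s : 0 <= s <= 1 -> F n.+1 s = E s * ((1 + phi n s) / 2) ^+ 2.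
Proof. by move=> s01; rewrite /F pgf_visitsS //= !flow_bush //; congr (_ * _); field. Qed.

Let HS n s : 0 <= s <= 1 -> H n.+1 s = E s * ((1 + phi n s) / 2).
Proof. by move=> s01; rewrite /H pgf_visitsS //= !flow_bush. Qed.

Let visits_spine n h s : 0 <= s <= 1 -> pgf_visits n h [::] s = H n s.
Proof.
by case: n => [//|n] s01; rewrite HS // pgf_visitsS //= !flow_bush.
Qed.

Let overflow_dep n m h : depends_on predT (overflow_of n m h).
Proof. exact: depends_onT (@depends_on_overflow n m h). Qed.

Definition pgf_overflow n m h s := pgf (overflow_of n m h) s.

Let load_dep n m h :
  depends_on predT (fun y => visits_of n h [::] y + overflow_of n m h.+1 y)%N.
Proof. by apply: (depends_on_comp2 addn). Qed.

Let pgf_load n m h s : 0 <= s <= 1 ->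
  pgf (fun y => visits_of n h [::] y + overflow_of n m h.+1 y)%N s =
  H n s * pgf_overflow n m h.+1 s.
Proof.
move=> s01; rewrite (@pgfD _ _ _ _ _ _ KX_indep (subtree h [::]) (from_level h.+1)) //.
- by rewrite -(visits_spine n h).
- by move=> i /andP[/eqP hi _]; rewrite /from_level hi ltnn.
- exact: depends_on_visits.
- exact: depends_on_overflow.
Qed.

Lemma pgf_overflowS n m h s : 0 <= s <= 1 -> s * pgf_overflow n m.+1 h s =
  pgf_overflow n m h.+1 s * H n s - (1 - s) * (pgf_overflow n m h.+1 0 * H n 0).
Proof.
move=> s01.
rewrite [LHS](pgf_pred coordinate (@load_dep n m h) s01) !pgf_load //.
by rewrite [H n s * _]mulrC [H n 0 * _]mulrC.
Qed.

(** Homogeneity of the spine: [pgf_overflowS] involves [h] only through the overflow from [h.+1]. *)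
Lemma pgf_overflow_shift n m h h' s : 0 <= s <= 1 ->
  pgf_overflow n m h s = pgf_overflow n m h' s.
Proof.
elim: m h h' s => [//|m IHm] h h'.
have pos s : 0 < s <= 1 -> pgf_overflow n m.+1 h s = pgf_overflow n m.+1 h' s.
  move=> /andP[s0 s1]; have s01 : 0 <= s <= 1 by rewrite ltW.
  apply: (mulfI (lt0r_neq0 s0)); rewrite !pgf_overflowS //.
  by rewrite (IHm h.+1 h'.+1 s) // (IHm h.+1 h'.+1 0).
move=> s /andP[]; rewrite le_eqVlt => /predU1P[<- _|s0 s1]; last by rewrite pos // s0.
by apply: pgf_eq0 => //; exact: overflow_dep.
Qed.

Lemma pgf_overflow_cvg : pgf_overflow n n 0 0 @[n --> \oo] -->
  (if alpha <= 2 - Num.sqrt 2 then expR (alpha / 2) *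
     Num.sqrt ((alpha ^+ 2 - 4 * alpha + 2) / (2 * (1 - alpha))) else 0).
Proof.
have pgf0 (Z : (vertex + vertex -> nat) -> nat) s : Z =1 (fun=> 0%N) -> pgf Z s = 1.
  by move=> Z0; rewrite -[RHS](expect_cst coordinate 1); apply: expect_eq => y; rewrite Z0 expr0.
apply: (@g_diag_cvg R alpha F phi H (fun n m s => pgf_overflow n m 0 s)) => //.
- by move=> n s s01; exact: pgf_unit.
- by move=> n s s01; exact: pgf_unit.
- by move=> n s s01; exact: pgf_unit.
- by move=> n m s s01; exact: pgf_unit.
- by move=> n s s01; apply: pgf_le => // y; exact: visits_leS.
- by move=> n s s01; apply: pgf_le => // y; exact: visits_leS.
- by move=> n s t s0 st t1; exact: pgf_homo.
- by move=> n s s01; apply: pgf_le => // y; exact: leq_pred.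
- by move=> n s s01; exact: pgf_pred.
- by move=> s s01; exact: pgf0.
- by move=> s s01; exact: pgf0.
- by move=> n s s01; exact: pgf0.
- by move=> n m s s01; rewrite pgf_overflowS // !(@pgf_overflow_shift n m 1%N 0%N).
- move=> n m s s01; rewrite mulrC (@pgf_overflow_shift n m 0%N 1%N) // -pgf_load //.
  by apply: pgf_le => // y; exact: leq_pred.
- by move=> n m n' m' s nn' mm' s01; apply: pgf_le => // y; exact: overflow_homo.
Qed.
Let extinct_dep n h w : depends_on predT (extinct_of n h w).
Proof. exact: depends_onT (@depends_on_extinct n h w). Qed.

(* The survival probability u of a critical binary tree satisfies
   u_{n+1} = u_n - u_n^2 / 4. *)
Lemma extinct_prob_ge n h w : w != [::] ->
  1 - 4 / (n%:R + 4) <= expect (fun y => (extinct_of n h w y)%:R) <= 1.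
Proof.
elim: n h w => [|n IHn] h w w0.
  rewrite (@expect_eq _ _ _ _ _ _ _ (fun=> 0)) // expect_cst.
  by rewrite add0r divff // subrr lexx ler01.
pose f j y : R := (extinct_of n h (rcons w j) y)%:R.
have rn j : rcons w j != [::] by case: w {w0 f}.
have df j : depends_on (subtree h (rcons w j)) (f j).
  exact: (depends_on_comp (fun b : bool => b%:R) (@depends_on_extinct n h (rcons w j))).
have uf j : unit_valued (f j) by exact: unit_valued_bool.
have [inl0 _] := subtree_root h w 0; have [inl1 _] := subtree_root h w 1.
rewrite (@expect_eq _ _ _ _ _ _ _ (fun y => branch (y (inl (h, w))) (f 0 y) (f 1 y))); last first.
  move=> y; rewrite /branch /f /extinct_of /=.
  case: (y (inl (h, w))) => [|[|k]] /=; rewrite ?mul0r ?mul1r ?add0r ?addr0 //.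
    by case: (extinct _ _ _ _).
  by case: (extinct _ _ _ _); case: (extinct _ _ _ _); rewrite /= ?mulr0 ?mulr1.
rewrite (@expect_branch _ _ _ _ _ _ KX_indep _ _ _ _ _ (@subtree_sibling h w)
  _ _ (df 0) (df 1)) ?inl0 ?inl1 //.
have := offspring_pmf h w; rewrite (negbTE w0) => -[-> ->].
have /andP[a0 a1] := IHn h _ (rn 0); have /andP[b0 b1] := IHn h _ (rn 1).
rewrite -/(f 0) in a0 a1; rewrite -/(f 1) in b0 b1.
set a := expect (f 0) in a0 a1 *; set b := expect (f 1) in b0 b1 *.
have n0 : 0 <= n%:R :> R by [].
set t := 4 / (n%:R + 4) in a0 b0.
have t1 : t <= 1 by rewrite ler_pdivrMr; lra.
have t0 : 0 <= t by rewrite divr_ge0 //; lra.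
(* 4 / (n + 4) starts at 1 and decreases no faster than the recursion u - u^2 / 4. *)
have tS : t - t ^+ 2 / 4 <= 4 / (n.+1%:R + 4).
  rewrite ler_pdivlMr -(natr1 n); last by lra.
  have -> : (t - t ^+ 2 / 4) * (n%:R + 1 + 4) = 4 - 4 / (n%:R + 4) ^+ 2.
    by rewrite /t; field; lra.
  by rewrite gerBl divr_ge0 // sqr_ge0.
have ab : (1 - t) * (1 - t) <= a * b by apply: ler_pM => //; lra.
have ab1 : a * b <= 1 by rewrite mulr_ile1 //; lra.
by apply/andP; split; lra.
Qed.

(** Survival for [n] generations has probability at most 4 / (n + 4), which tends to 0. *)
Lemma extinction_ae h w : w != [::] ->
  P (\bigcap_n ~` [set om | extinct_of n h w (coordinate^~ om)]) = 0%E.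
Proof.
move=> w0; set D := fun n => [set om | extinct_of n h w (coordinate^~ om)].
have mD n : measurable (D n) by exact: measurable_event.
have mN : measurable (\bigcap_n ~` D n).
  by apply: bigcapT_measurable => n; exact: measurableC.
have PN n : (P (\bigcap_n ~` D n) <= (4 / (n%:R + 4))%:E)%E.
  apply: (@le_trans _ _ (P (~` D n))).
    apply: le_measure; rewrite ?inE //; first exact: measurableC.
    exact: bigcap_inf.
  rewrite probability_setC // -expect_event // -EFinB lee_fin.
  by have /andP[] := extinct_prob_ge n h w0; lra.
have := PN; rewrite -(fineK (fin_num_measure P _ mN)) => PN'.
set x := fine _ in PN' *; congr _%:E; apply/eqP; rewrite eq_le fine_ge0 ?measure_ge0 // andbT.
rewrite leNgt; apply/negP => x0.
have := PN' (Num.bound (4 / x)); rewrite lee_fin.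
have b0 : 0 <= (Num.bound (4 / x))%:R :> R by [].
rewrite ler_pdivlMr; last by lra.
apply/negP; rewrite -ltNge mulrDr.
have := archi_boundP (divr_ge0 (ler0n R 4) (ltW x0)).
rewrite ltr_pdivrMr // mulrC => lt4.
by apply: (lt_trans lt4); rewrite ltrDl mulr_gt0.
Qed.

(** The masses at 0, 1 and 2 sum to 1, on and off the spine. *)
Lemma offspring_le2_ae v : P [set om | (2 < K v om)%N] = 0%E.
Proof.
case: v => h w; pose i : vertex + vertex := inl (h, w).
pose p j := expect (fun y => (y i == j)%:R).
have p3 : p 0%N + (p 1%N + p 2) = 1.
  have pE j : p j = fine (distribution P (K (h, w)) [set j]).
    by rewrite -(expect_pmf coordinate i).
  rewrite !pE; have [->|/eqP w0] := eqVneq w [::].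
    by rewrite !K_spine !nu_set1 /= binn bin1 bin_small //; field.
  by rewrite !(K_bush _ w0) !nu_set1 /= bin0 bin1 binn; field.
have db (b : pred nat) : depends_on predT (fun y => b (y i)).
  exact/(depends_on_comp b)/depends_on_coord.
have dbR (b : pred nat) : depends_on predT (fun y => (b (y i))%:R : R).
  exact: (depends_on_comp (fun c : bool => c%:R) (db b)).
have ub (b : pred nat) : unit_valued (fun y => (b (y i))%:R : R).
  by move=> y; case: (b _); rewrite lexx ler01.
have -> : [set om | (2 < K (h, w) om)%N] = [set om | (fun n => 2 < n)%N (coordinate^~ om i)] by [].
rewrite -(expect_event coordinate (db (fun n => 2 < n)%N)); congr _%:E.
have q : expect (fun y => (y i <= 2)%N%:R) = 1.
  have d12 := depends_on_comp2 +%R (dbR (pred1 1%N)) (dbR (pred1 2)).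
  have u12 : unit_valued (fun y => (y i == 1%N)%:R + (y i == 2)%:R : R).
    by move=> y; case: (y i) => [|[|[|k]]] /=; rewrite ?add0r ?addr0 ?lexx ?ler01.
  rewrite -[RHS]p3 -(expectD _ (dbR (pred1 1%N)) (dbR (pred1 2)) (ub _) (ub _)).
  rewrite -(expectD _ (dbR (pred1 0%N)) d12 (ub _) u12).
  by apply: expect_eq => y; case: (y i) => [|[|[|k]]] /=; rewrite ?add0r ?addr0.
have : expect (fun y => (y i <= 2)%N%:R + (2 < y i)%N%:R) = 1.
  rewrite -[RHS](expect_cst coordinate 1); apply: expect_eq => y.
  by rewrite ltnNge; case: leqP; rewrite ?addr0 ?add0r.
rewrite (expectD _ (dbR (fun n => n <= 2)%N) (dbR (fun n => 2 < n)%N) (ub _) (ub _)).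
by rewrite q => /eqP; rewrite -subr_eq0 addrAC subrr add0r => /eqP.
Qed.

Let A := [set om | all_cars_park (K^~ om) (X^~ om)].

(** Levels, finite car lists and vertices are all countable, so the event is built countably from
    conditions on finitely many coordinates. *)
Lemma measurable_all_cars_park : measurable A.
Proof.
pose L h (r : seq vertex) v : set Omega :=
  [set om | count_mem v r ==
    if (v.1 <= h)%N && in_tree (K^~ om) v then X v om else 0%N].
have mL h r v : measurable (L h r v).
  exact: (measurable_event coordinate (depends_on_lists_arrivals h r v)).
have -> : A = \bigcap_h \bigcup_r
    (if cars_leaving r == 0%N then \bigcap_v L h r v else set0).
  apply/seteqP; split => om /=.
    move=> park h _; have [r sP s0] := park h; exists r => //.
    by rewrite s0 eqxx => v _; apply/eqP.
  move=> park h; have [r _] := park h I.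
  case: eqP => // s0 sP; exists r => // v; apply/eqP; exact: (sP v I).
apply: bigcapT_measurable => h.
apply: countable_bigcupT_measurable => [|r]; first exact: countableP.
case: ifP => // _; rewrite -[X in measurable X]setCK setC_bigcap.
apply/measurableC/countable_bigcupT_measurable => [|v]; first exact: countableP.
exact: measurableC.
Qed.

Lemma negligible_bigcup_countable (T : countType) (N : T -> set Omega) :
  (forall t, P.-negligible (N t)) -> P.-negligible (\bigcup_t N t).
Proof.
move=> nN.
apply: (@negligibleS _ _ _ _ (\bigcup_n (if unpickle n is Some t then N t else set0))).
  by move=> om [t _ Nt]; exists (pickle t) => //; rewrite pickleK.
apply: negligible_bigcup => n; case: unpickle => [t|]; first exact: nN.
exact: negligible_set0.
Qed.

(** The null set collects offspring numbers above 2 and off-spine subtrees that never die out;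
    outside it the deterministic equivalence applies. *)
Lemma all_cars_park_ae : exists N, [/\ measurable N, P N = 0%E &
  forall om, ~ N om ->
    A om <-> forall n, overflow_of n n 0 (coordinate^~ om) = 0%N].
Proof.
pose N1 := \bigcup_v [set om | (2 < K v om)%N].
pose N2 := \bigcup_(v : vertex) (if v.2 == [::] then set0 else
  \bigcap_n ~` [set om | extinct_of n v.1 v.2 (coordinate^~ om)]).
have [N [mN PN NN]] : P.-negligible (N1 `|` N2).
  apply: negligibleU; apply: negligible_bigcup_countable => v.
    apply/negligibleP; last exact: offspring_le2_ae.
    by apply: (measurable_event coordinate (b := fun y => 2 < y (inl v))%N);
      exact/(depends_on_comp (fun n => 2 < n)%N)/depends_on_coord.
  case: eqP => [_|/eqP v0]; first exact: negligible_set0.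
  apply/negligibleP; last exact: extinction_ae.
  by apply: bigcapT_measurable => n; apply: measurableC; exact: measurable_event.
exists N; split => // om Nom.
have k2 v : (K v om <= 2)%N.
  by rewrite leqNgt; apply/negP => kv; apply: Nom; apply: NN; left; exists v.
split=> [park n|ov0].
  exact: (all_cars_park_overflow0 k2 park).
apply: overflow0_all_cars_park => // h.
have ext j : exists n, extinct (K^~ om) n h [:: j].
  apply: contrapT => noext; apply: Nom; apply: NN; right.
  exists (h, [:: j]) => //= n _ en; apply: noext; exists n; exact: en.
have extS n m w : extinct (K^~ om) n h w -> extinct (K^~ om) (n + m) h w.
  elim: n w => // n IHn w /= /andP[/implyP e0 /implyP e1].
  by apply/andP; split; apply/implyP => k0; apply: IHn; [exact: e0|exact: e1].
have [[n0 e0] [n1 e1]] := (ext 0%N, ext 1%N).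
(* [extinct] is monotone in the number of generations, so the sum serves both children; the
   successor is the step from S_h. *)
exists (n0 + n1).+1; apply/andP; split; apply/implyP => _; first exact: extS.
by rewrite addnC; exact: extS.
Qed.

(** The events [B n] decrease because the overflow grows, so continuity from above applies; their
    probabilities are generating functions at 0. *)
Lemma prob_all_cars_park : P A =
  (if alpha <= 2 - Num.sqrt 2 then expR (alpha / 2) *
     Num.sqrt ((alpha ^+ 2 - 4 * alpha + 2) / (2 * (1 - alpha))) else 0)%:E.
Proof.
pose B n := [set om | overflow_of n n 0 (coordinate^~ om) == 0%N].
have dep n : depends_on predT (fun y => overflow_of n n 0 y == 0%N).
  exact/(depends_on_comp (eq_op^~ 0%N))/(depends_onT (@depends_on_overflow n n 0)).
have mB n : measurable (B n) by exact: (measurable_event coordinate (dep n)).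
have mBI : measurable (\bigcap_n B n) by exact: bigcapT_measurable.
have PB n : P (B n) = (pgf_overflow n n 0 0)%:E.
  rewrite /B -(expect_event coordinate (dep n)); congr _%:E.
  by apply: expect_eq => y; rewrite expr0n.
have [N [mN PN AB]] := all_cars_park_ae.
have mA := measurable_all_cars_park.
have PAB : P A = P (\bigcap_n B n).
  have sub C D : measurable C -> measurable D ->
      (forall om, ~ N om -> C om -> D om) -> (P C <= P D)%E.
    move=> mC mD CD; apply: (@le_trans _ _ (P (D `|` N))).
      apply: le_measure; rewrite ?inE //; first exact: measurableU.
      by move=> om Com; have [Nom|Nom] := pselect (N om); [right|left; exact: CD].
    apply: (le_trans (measureU2 _ _ _)) => //.
    by rewrite [X in (_ + X)%E]PN adde0.
  apply/eqP; rewrite eq_le; apply/andP; split; apply: sub => // om Nom.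
    by move=> /(AB om Nom) ov n _; apply/eqP.
  by move=> ov; apply/(AB om Nom) => n; apply/eqP; exact: ov.
have cvB : P (B n) @[n --> \oo] --> P (\bigcap_n B n).
  apply: (@nonincreasing_cvg_mu _ _ _ P B) => //.
    by rewrite (le_lt_trans (probability_le1 _ _)) // ltry.
  move=> n m nm; apply/subsetPset => om; rewrite /B /= => /eqP ov0.
  rewrite -leqn0 -[X in (_ <= X)%N]ov0; exact: overflow_homo.
rewrite PAB; apply/esym/(cvg_unique _ _ cvB) => //.
rewrite (_ : (fun n => P (B n)) = EFin \o (fun n => pgf_overflow n n 0 0)).
  by apply: cvg_EFin; [exact: nearW|exact: pgf_overflow_cvg].
by apply/funext => n; rewrite /= PB.
Qed.

End KestenTree.

Unset Implicit Arguments.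

Theorem theorem3p3 (R : realType) (d : measure_display)
    (Omega : measurableType d) (P : probability Omega R) (alpha : R)
    (K X : vertex -> {RV P >-> nat})
    (alpha_ge0 : 0 <= alpha)
    (K_spine : forall h i : nat,
      distribution P (K (h, [::])) [set i] =
        ((i.+1%:R)%:E * nu R [set i.+1])%E)
    (K_bush : forall (h : nat) (w : seq nat), w <> [::] ->
      forall B : set nat, distribution P (K (h, w)) B = nu R B)
    (X_law : forall (v : vertex) (B : set nat),
      distribution P (X v) B = Po alpha B)
    (KX_indep : mutually_independent
      (fun a : vertex + vertex =>
         match a with inl v => K v | inr v => X v end)) :
  let A := [set omega | all_cars_park (K^~ omega) (X^~ omega)] in
  measurable A /\
  P A = (if alpha <= 2 - Num.sqrt 2 then
           expR (alpha / 2) *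
           Num.sqrt ((alpha ^+ 2 - 4 * alpha + 2) / (2 * (1 - alpha)))
         else 0)%:E.
Proof.
split; first exact: measurable_all_cars_park.
exact: (prob_all_cars_park alpha_ge0 K_spine K_bush X_law KX_indep).
Qed.
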